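(* $\mathrm{MC}(\times,/)$ is $\mathrm{PL}$-hard under logarithmic-space many-one reductions.
   Context: Natural numbers include $0$. For $A,B\subseteq\mathbb N$: $A\cup B$, $A\cap B$ are the usual operations, $\overline{A}=\mathbb N\setminus A$, $A+B=\{a+b: a\in A, b\in B\}$, $A\times B=\{a\cdot b: a\in A, b\in B\}$, and $A/B=\{c\in\mathbb N:\exists a\in A\ \exists b\in B\setminus\{0\}: a=c\cdot b\}$ (exact integer division without remainder or rounding). For $\emptyset\ne\mathcal O\subseteq\{\cup,\cap,\overline{\phantom{c}},+,\times,/\}$, an $\mathcal O$-circuit $C=(V,E,g_C,\alpha)$ is a finite acyclic directed multigraph with gate set $V\subseteq\mathbb N$, every gate having indegree $0$, $1$ or $2$, a designated output gate $g_C\in V$, and a labeling $\alpha$: gates of indegree $0$ (input gates) are labeled by natural numbers, gates of indegree $1$ are labeled $\overline{\phantom{c}}$ (allowed only if $\overline{\phantom{c}}\in\mathcal O$), and gates of indegree $2$ are labeled by an operation in $\mathcal O\setminus\{\overline{\phantom{c}}\}$. The result set $I(g)\subseteq\mathbb N$ is defined inductively: $I(g)=\{\alpha(g)\}$ for an input gate; $I(g)=\mathbb N\setminus I(p)$ for a complement gate with predecessor $p$; $I(g)=I(g_1)\,\sigma\,I(g_2)$ for a gate labeled $\sigma$ with predecessors $g_1\le g_2$ (a double edge from one gate gives $g_1=g_2$). $I(C)=I(g_C)$. A circuit is encoded as a bit string listing its gates in reverse topological order, each gate as the triple (gate name, label, list of predecessors), with all numbers (including input labels) in binary; $|C|$ denotes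 the length of this encoding. The membership problem is $\mathrm{MC}(\mathcal O)=\{(C,b): C \text{ is an } \mathcal O\text{-circuit},\ b\in\mathbb N,\ b\in I(C)\}$, with $b$ given in binary; $\mathrm{MC}(\sigma_1,\dots,\sigma_n)$ abbreviates $\mathrm{MC}(\{\sigma_1,\dots,\sigma_n\})$. $\mathrm{PL}$ is the class of languages accepted by probabilistic Turing machines running in polynomial time and logarithmic space with acceptance probability strictly greater than $1/2$. *)

(* Defs.v *)
From mathcomp Require Import all_boot.
Unset Printing Implicit Defensive.

Inductive op := OCup | OCap | OCompl | OPlus | OTimes | ODiv.

Definition op_code (o : op) : nat :=
  match o with OCup => 0 | OCap => 1 | OCompl => 2 | OPlus => 3 | OTimes => 4 | ODiv => 5 end.

(* binary operation semantics (OCompl is unary; its binary reading is unused) *)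
Definition opsem (o : op) (A B : nat -> Prop) : nat -> Prop :=
  match o with
  | OCup => fun c => A c \/ B c
  | OCap => fun c => A c /\ B c
  | OCompl => fun c => ~ A c
  | OPlus => fun c => exists a b, A a /\ B b /\ c = a + b
  | OTimes => fun c => exists a b, A a /\ B b /\ c = a * b
  | ODiv => fun c => exists a b, A a /\ B b /\ b <> 0 /\ a = c * b
  end.

Inductive label := LIn of nat | LCompl | LBin of op.

Definition gate := (nat * label * seq nat)%type.
Definition gname (g : gate) : nat := g.1.1.
Definition glabel (g : gate) : label := g.1.2.
Definition gpreds (g : gate) : seq nat := g.2.

(* a circuit: (output gate name, gates listed in reverse topological order) *)
Definition circuit := (nat * seq gate)%type.

(* the gate at position i is well formed w.r.t. the set of allowed operations O:
   its predecessors all occur strictly later in the list (reverse topological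
   order, hence acyclicity), and its indegree matches its label *)
Definition gate_ok (O : op -> bool) (gs : seq gate) (i : nat) : Prop :=
  let g := nth (0, LIn 0, [::]) gs i in
  (forall p, p \in gpreds g -> p \in map gname (drop i.+1 gs)) /\
  match glabel g with
  | LIn _ => size (gpreds g) = 0
  | LCompl => O OCompl /\ size (gpreds g) = 1
  | LBin o => o <> OCompl /\ O o /\ size (gpreds g) = 2
  end.

Definition circuit_ok (O : op -> bool) (C : circuit) : Prop :=
  uniq (map gname C.2) /\ C.1 \in map gname C.2 /\
  forall i, i < size C.2 -> gate_ok O C.2 i.

Definition gval (I : nat -> nat -> Prop) (g : gate) : nat -> Prop :=
  match glabel g with
  | LIn v => fun c => c = v
  | LCompl => fun c => ~ I (nth 0 (gpreds g) 0) c
  | LBin o =>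
      let p := nth 0 (gpreds g) 0 in let q := nth 0 (gpreds g) 1 in
      opsem o (I (minn p q)) (I (maxn p q))
  end.

Fixpoint geval (gs : seq gate) (n : nat) : nat -> Prop :=
  match gs with
  | [::] => fun _ => False
  | g :: l => if gname g == n then gval (geval l) g else geval l n
  end.

Definition circ_val (C : circuit) : nat -> Prop := geval C.2 C.1.

Fixpoint bin_aux (fuel n : nat) : seq bool :=
  match fuel with
  | 0 => [::]
  | f.+1 => if n is 0 then [::] else rcons (bin_aux f n./2) (odd n)
  end.
Definition bin (n : nat) : seq bool := if n == 0 then [:: false] else bin_aux n n.

(* self-delimiting encoding of a number: each binary digit d as "1d", end "00" *)
Definition encN (n : nat) : seq bool :=
  flatten (map (fun d => [:: true; d]) (bin n)) ++ [:: false; false].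

Definition enc_label (l : label) : seq bool :=
  match l with
  | LIn v => encN 0 ++ encN v
  | LCompl => encN 1
  | LBin o => encN (2 + op_code o)
  end.

Definition enc_gate (g : gate) : seq bool :=
  encN (gname g) ++ enc_label (glabel g) ++ encN (size (gpreds g))
  ++ flatten (map encN (gpreds g)).

Definition enc_circuit (C : circuit) : seq bool :=
  encN C.1 ++ encN (size C.2) ++ flatten (map enc_gate C.2).

Definition enc_instance (C : circuit) (b : nat) : seq bool :=
  enc_circuit C ++ encN b.

Definition MC (O : op -> bool) (x : seq bool) : Prop :=
  exists (C : circuit) (b : nat),
    circuit_ok O C /\ x = enc_instance C b /\ circ_val C b.

Definition O_times_div (o : op) : bool :=
  match o with OTimes | ODiv => true | _ => false end.

Inductive move := MLeft | MStay | MRight.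
Definition mv (m : move) (p : nat) : nat :=
  match m with MLeft => p.-1 | MStay => p | MRight => p.+1 end.

(* symbol under input head: cells 0..n-1 hold the input, cell n is the end marker *)
Definition rd (x : seq bool) (i : nat) : option bool :=
  if i < size x then Some (nth false x i) else None.

Definition logbound (c n : nat) : nat := c * (trunc_log 2 n).+1.

(* probabilistic TM: the transition also reads a fresh random bit *)
Record PTM := {
  ptm_Q : finType; ptm_G : finType; ptm_blank : ptm_G; ptm_start : ptm_Q;
  ptm_halt : ptm_Q -> bool; ptm_acc : ptm_Q -> bool;
  ptm_delta : ptm_Q -> option bool -> ptm_G -> bool ->
              ptm_Q * ptm_G * move * move }.
Arguments ptm_halt : clear implicits.
Arguments ptm_acc : clear implicits.
Arguments ptm_delta : clear implicits.

(* configuration: (state, input head, work tape, work head) *)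
Definition pcfg (M : PTM) := (ptm_Q M * nat * (nat -> ptm_G M) * nat)%type.

Definition pinit (M : PTM) : pcfg M := (ptm_start M, 0, fun _ => ptm_blank M, 0).

Definition pstep (M : PTM) (x : seq bool) (c : pcfg M) (coin : bool) : pcfg M :=
  let: (q, i, tp, j) := c in
  if ptm_halt M q then c else
  let: (q', a, mi, mw) := ptm_delta M q (rd x i) (tp j) coin in
  (q', minn (mv mi i) (size x), fun k => if k == j then a else tp k, mv mw j).

Definition prun (M : PTM) (x : seq bool) (cs : seq bool) : pcfg M :=
  foldl (pstep M x) (pinit M) cs.

Definition PL (L : seq bool -> Prop) : Prop :=
  exists (M : PTM) (k c : nat), forall x : seq bool,
    let T := (size x).+2 ^ k in
    (forall cs : T.-tuple bool, ptm_halt M (prun M x cs).1.1.1) /\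
    (forall cs : seq bool, size cs <= T -> (prun M x cs).2 <= logbound c (size x)) /\
    (L x <-> 2 ^ T < 2 * #|[set cs : T.-tuple bool | ptm_acc M (prun M x cs).1.1.1]|).

(* deterministic logspace transducer with write-only output tape *)
Record LTM := {
  ltm_Q : finType; ltm_G : finType; ltm_blank : ltm_G; ltm_start : ltm_Q;
  ltm_halt : ltm_Q -> bool;
  ltm_delta : ltm_Q -> option bool -> ltm_G ->
              ltm_Q * ltm_G * move * move * option bool }.
Arguments ltm_halt : clear implicits.
Arguments ltm_delta : clear implicits.

(* configuration: (state, input head, work tape, work head, output so far) *)
Definition lcfg (M : LTM) := (ltm_Q M * nat * (nat -> ltm_G M) * nat * seq bool)%type.

Definition linit (M : LTM) : lcfg M := (ltm_start M, 0, fun _ => ltm_blank M, 0, [::]).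

Definition lstep (M : LTM) (x : seq bool) (c : lcfg M) : lcfg M :=
  let: (q, i, tp, j, out) := c in
  if ltm_halt M q then c else
  let: (q', a, mi, mw, o) := ltm_delta M q (rd x i) (tp j) in
  (q', minn (mv mi i) (size x), fun k => if k == j then a else tp k, mv mw j,
   out ++ (if o is Some b then [:: b] else [::])).

Definition lrun (M : LTM) (x : seq bool) (t : nat) : lcfg M := iter t (lstep M x) (linit M).

Definition logspace_computable (f : seq bool -> seq bool) : Prop :=
  exists (M : LTM) (c : nat), forall x : seq bool,
    (exists t, ltm_halt M (lrun M x t).1.1.1.1 /\ (lrun M x t).2 = f x) /\
    (forall t, (lrun M x t).1.2 <= logbound c (size x)).

Definition logspace_reduces (L L' : seq bool -> Prop) : Prop :=
  exists f, logspace_computable f /\ forall x, L x <-> L' (f x).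

Definition PL_hard (L' : seq bool -> Prop) : Prop :=
  forall L, PL L -> logspace_reduces L L'.

(* Main.v *)
Require Import Defs.
From mathcomp Require Import all_boot zify.
From Stdlib Require Import FunctionalExtensionality.
Set Implicit Arguments.
Unset Strict Implicit.
Unset Printing Implicit Defensive.

(* Fix a PL machine with clock T. Give every pair (t, a) of a number of remaining
   steps and a configuration a gate of value {2 ^ N}, where N is the number of
   accepting continuations of length t: at t = 0 it is an input gate 1 or 2, and
   otherwise it is the product of the gates of the two successors of a at t - 1.
   A configuration that accepts forever yields the value 2 ^ (2 ^ T), so that the
   quotient of (2 ^ N) ^ 2 by 2 * 2 ^ (2 ^ T) is nonempty exactly when
   2 * N > 2 ^ T; multiplying it by {0} gives a set that contains 0 in exactly this
   case.

   Configurations are coded by polynomially bounded numbers, with the work tape as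
   two stacks in a fixed base, and gates are named 0, 1, 2, ... so that predecessors
   have smaller names. The label and the predecessors of a gate are then given by
   arithmetic expressions in the gate name, the input length and the input bits.
   Such an expression has polynomially bounded intermediate values, so a transducer
   evaluates it with binary counters stored in parallel on a logarithmic tape. *)

(** * Structured Turing machines *)

(** Products and exact quotients cannot add values, but they add and compare exponents of 2. Counts
    therefore live in exponents, and the labels 0, 1 and 2 suffice although gate values are doubly
    exponential. The extra factor 2 comes from strictness: [2 * N > 2 ^ T] means
    [2 ^ T + 1 <= 2 * N]. The quotient itself cannot be queried, since its value depends on N; after
    the product with {0} only emptiness is left, and the queried number is always 0. There is a gate
    for every number below the code bound, even for numbers that code no configuration. These gates
    must be well formed too, hence a numerical transition that is total and reduced modulo the
    bound; they never reach the output. A transducer must halt within its space bound, but in no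
    prescribed time. All arithmetic can thus count up and down by one, and the largest counter value
    is the only resource to control. *)

Section Machines.
Variable G : finType.

Definition tst : Type := (nat * (nat -> G) * nat * seq bool)%type.
Definition action : Type := (G * move * move * option bool)%type.

(* The exit value of a machine is a boolean, so that machines can serve as tests. *)
Record mach := Mach {
  mQ : finType;
  mstart : mQ;
  mdelta : mQ -> option bool -> G -> (mQ + bool) * action }.

Definition apply (x : seq bool) (s : tst) (a : action) : tst :=
  let: (i, tp, j, out) := s in
  let: (g, mi, mw, o) := a in
  (minn (mv mi i) (size x), fun k => if k == j then g else tp k, mv mw j,
   out ++ (if o is Some b then [:: b] else [::])).

Definition mstep (x : seq bool) (M : mach) (q : mQ M) (s : tst) :
    (mQ M + bool) * tst :=
  let r := mdelta q (rd x s.1.1.1) (s.1.1.2 s.1.2) in (r.1, apply x s r.2).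

Variables (x : seq bool) (B : nat).

(** Derivations are finite and check the head position at every configuration, so one judgement
    carries both termination and the space bound [B]. *)
Inductive run (M : mach) : mQ M + bool -> tst -> bool -> tst -> Prop :=
| run_exit b s : s.1.2 <= B -> run (inr b) s b s
| run_step q s b s' : s.1.2 <= B ->
    run (mstep x q s).1 (mstep x q s).2 b s' -> run (inl q) s b s'.

Definition exec (M : mach) (s : tst) (b : bool) (s' : tst) : Prop :=
  run (inl (mstart M)) s b s'.

Definition act (f : option bool -> G -> bool * action) : mach :=
  @Mach unit tt (fun _ r g => (inr (f r g).1, (f r g).2)).

Lemma exec_act f (i : nat) tp j o (s' : tst) (b : bool) :
  j <= B -> s'.1.2 <= B ->
  (f (rd x i) (tp j)).1 = b -> apply x (i, tp, j, o) (f (rd x i) (tp j)).2 = s' ->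
  exec (act f) (i, tp, j, o) b s'.
Proof.
move=> hj hj' <- es; apply: run_step => //.
by move: (run_exit (act f) (f (rd x i) (tp j)).1 hj'); rewrite -es.
Qed.

Definition ifm (T M1 M2 : mach) : mach :=
  @Mach (mQ T + (mQ M1 + mQ M2))%type (inl (mstart T))
    (fun q r g => match q with
     | inl q => let d := mdelta q r g in
        (match d.1 with
         | inl q' => inl (inl q')
         | inr true => inl (inr (inl (mstart M1)))
         | inr false => inl (inr (inr (mstart M2))) end, d.2)
     | inr (inl q) => let d := mdelta q r g in
        (match d.1 with inl q' => inl (inr (inl q')) | inr b => inr b end, d.2)
     | inr (inr q) => let d := mdelta q r g in
        (match d.1 with inl q' => inl (inr (inr q')) | inr b => inr b end, d.2)
     end).

Definition seqm (M1 M2 : mach) : mach := ifm M1 M2 M2.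

Definition whilem (T M : mach) : mach :=
  @Mach (mQ T + mQ M)%type (inl (mstart T))
    (fun q r g => match q with
     | inl q => let d := mdelta q r g in
        (match d.1 with
         | inl q' => inl (inl q')
         | inr true => inl (inr (mstart M))
         | inr false => inr false end, d.2)
     | inr q => let d := mdelta q r g in
        (match d.1 with inl q' => inl (inr q') | inr b => inl (inl (mstart T)) end, d.2)
     end).

Lemma exec_if T M1 M2 s b s1 b' s' :
  exec T s b s1 -> exec (if b then M1 else M2) s1 b' s' ->
  exec (ifm T M1 M2) s b' s'.
Proof.
rewrite /exec => H1 H2.
have H2' : run (M := ifm T M1 M2)
   (inl (inr (if b then inl (mstart M1) else inr (mstart M2)))) s1 b' s'.
  case: b {H1} H2.
  - rewrite /exec => H.
    suff: forall q s, run q s b' s' -> run (M := ifm T M1 M2)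
       (match q with inl q' => inl (inr (inl q')) | inr b => inr b end) s b' s'.
      by move=> /(_ _ _ H).
    move=> q {}s; elim=> [{}b {}s hs|{}q {}s {}b s2 hs _ IH]; first exact: run_exit.
    by apply: run_step.
  - rewrite /exec => H.
    suff: forall q s, run q s b' s' -> run (M := ifm T M1 M2)
       (match q with inl q' => inl (inr (inr q')) | inr b => inr b end) s b' s'.
      by move=> /(_ _ _ H).
    move=> q {}s; elim=> [{}b {}s hs|{}q {}s {}b s2 hs _ IH]; first exact: run_exit.
    by apply: run_step.
suff: forall q s, run q s b s1 -> run (M := ifm T M1 M2)
   (match q with inl q' => inl (inl q') | inr true => inl (inr (inl (mstart M1)))
         | inr false => inl (inr (inr (mstart M2))) end) s b' s'.
  by move=> /(_ _ _ H1).
move=> q {H1 H2} {}s H; elim: H H2' => [{}b {}s hs|{}q {}s {}b s2 hs _ IH] H2'.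
  by case: b H2'.
by apply: run_step => //=; exact: IH.
Qed.

Lemma exec_seq M1 M2 s b s1 b' s' :
  exec M1 s b s1 -> exec M2 s1 b' s' -> exec (seqm M1 M2) s b' s'.
Proof. by move=> H1 H2; apply: exec_if H1 _; case: b. Qed.

Lemma exec_while0 T M s s' : exec T s false s' -> exec (whilem T M) s false s'.
Proof.
rewrite /exec => H1.
suff: forall q s b, run q s b s' -> b = false -> run (M := whilem T M)
   (match q with inl q' => inl (inl q') | inr true => inl (inr (mstart M))
         | inr false => inr false end) s false s'.
  by move=> /(_ _ _ _ H1 erefl).
move=> q {H1} {}s b0; elim=> [{}b {}s hs ->|{}q {}s {}b s2 hs _ IH e]; first exact: run_exit.
by apply: run_step => //=; exact: IH.
Qed.

Lemma exec_while1 T M s s1 b s2 s' :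
  exec T s true s1 -> exec M s1 b s2 -> exec (whilem T M) s2 false s' ->
  exec (whilem T M) s false s'.
Proof.
rewrite /exec => H1 H2 H3.
have {}H2 : run (M := whilem T M) (inl (inr (mstart M))) s1 false s'.
  suff: forall q s, run q s b s2 -> run (M := whilem T M)
     (match q with inl q' => inl (inr q') | inr b => inl (inl (mstart T)) end) s false s'.
    by move=> /(_ _ _ H2).
  move=> q {H1 H2} {}s H; elim: H H3 => // {}q {}s {}b {}s2 hs _ IH H3.
  by apply: run_step => //=; exact: IH.
suff: forall q s b, run q s b s1 -> b = true -> run (M := whilem T M)
   (match q with inl q' => inl (inl q') | inr true => inl (inr (mstart M))
         | inr false => inr false end) s false s'.
  by move=> /(_ _ _ _ H1 erefl).
move=> q {H1 H3} {}s b0 H; elim: H H2 => [{}b {}s hs|{}q {}s {}b {}s2 hs _ IH] H2 e.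
  by rewrite e.
by apply: run_step => //=; exact: IH.
Qed.

Definition test (P : option bool -> G -> bool) : mach :=
  act (fun r g => (P r g, (g, MStay, MStay, None))).

Definition put (h : G -> G) (mi mw : move) (o : option bool) : mach :=
  act (fun _ g => (true, (h g, mi, mw, o))).

Lemma exec_test P i tp j o b : i <= size x -> j <= B -> P (rd x i) (tp j) = b ->
  exec (test P) (i, tp, j, o) b (i, tp, j, o).
Proof.
move=> hi hj Pb; apply: exec_act => //=.
rewrite cats0 (minn_idPl hi); congr (_, _, _, _).
(* Every step writes; putting back the scanned symbol gives the old tape only up to
   extensionality. *)
by apply: functional_extensionality => k; case: eqP => [->|].
Qed.

Lemma exec_put h mi mw ob i tp j o i' tp' j' o' :
  j <= B -> j' <= B -> minn (mv mi i) (size x) = i' -> mv mw j = j' ->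
  (forall k, (if k == j then h (tp j) else tp k) = tp' k) ->
  o ++ (if ob is Some b then [:: b] else [::]) = o' ->
  exec (put h mi mw ob) (i, tp, j, o) true (i', tp', j', o').
Proof.
move=> hj hj' hi hm htp ho; apply: exec_act => //=; rewrite hi hm ho.
by congr (_, _, _, _); apply: functional_extensionality.
Qed.

End Machines.

(** * From structured machines to transducers *)

Section ToLTM.
Variables (G : finType) (blank : G) (M : mach G).

Definition ltm_of : LTM :=
  {| ltm_Q := (mQ M + bool)%type; ltm_G := G; ltm_blank := blank;
     ltm_start := inl (mstart M);
     ltm_halt := fun q => if q is inr _ then true else false;
     ltm_delta := fun q r g => match q with
       | inl q => let d := mdelta q r g in (d.1, d.2.1.1.1, d.2.1.1.2, d.2.1.2, d.2.2)
       | inr b => (inr b, g, MStay, MStay, None) end |}.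

(** Exit values become halting states, in which a configuration no longer changes, so the head bound
    along the run extends to all times. *)
Lemma ltm_of_run x B b s' :
  exec x B M (0, fun=> blank, 0, [::]) b s' ->
  (exists t, ltm_halt ltm_of (lrun ltm_of x t).1.1.1.1 /\ (lrun ltm_of x t).2 = s'.2) /\
  (forall t, (lrun ltm_of x t).1.2 <= B).
Proof.
rewrite /exec => H.
pose tocfg (c : mQ M + bool) (s : tst G) : lcfg ltm_of :=
  (c, s.1.1.1, s.1.1.2, s.1.2, s.2).
suff: forall q s, run x B q s b s' ->
  (exists t, ltm_halt ltm_of (iter t (lstep ltm_of x) (tocfg q s)).1.1.1.1 /\
     (iter t (lstep ltm_of x) (tocfg q s)).2 = s'.2) /\
  (forall t, (iter t (lstep ltm_of x) (tocfg q s)).1.2 <= B).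
  by move=> /(_ _ _ H).
move=> q s {H}; elim=> {}b {}s.
  move=> hs; split; first by exists 0.
  by move=> t; suff -> : iter t (lstep ltm_of x) (tocfg (inr b) s) = tocfg (inr b) s;
    last by elim: t => //= t ->.
move=> b' s2 hs _ [[t [h1 h2]] hB].
have E : lstep ltm_of x (tocfg (inl b) s) = tocfg (mstep x b s).1 (mstep x b s).2.
  rewrite /lstep /tocfg /mstep /=; case: s {hs h1 h2 hB} => [[[i tp] j] o] /=.
  by case: (mdelta _ _ _) => q' [[[a mi] mw] ob].
split; first by exists t.+1; rewrite iterSr E.
by case=> [|u] //; rewrite iterSr E.
Qed.

End ToLTM.

(** * Binary counters on the work tape *)

Definition nbit (v k : nat) : bool := odd (v %/ 2 ^ k).

Lemma nbit0 k : nbit 0 k = false.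
Proof. by rewrite /nbit div0n. Qed.

Lemma nbit_big v k : v < 2 ^ k -> nbit v k = false.
Proof. by move=> h; rewrite /nbit divn_small. Qed.

(** Adding 1 flips exactly the bits that the carry reaches, the positions k for which [2 ^ k]
    divides v + 1. The rule drives both increment and decrement. *)
Lemma nbitS v k : nbit v.+1 k = (2 ^ k %| v.+1) (+) nbit v k.
Proof. by rewrite /nbit divnS ?expn_gt0 // oddD; case: (_ %| _). Qed.

Lemma dvd_nbit v k : 2 ^ k %| v -> (2 ^ k.+1 %| v) = ~~ nbit v k.
Proof.
case/dvdnP => u ->; rewrite /nbit mulnK ?expn_gt0 // expnS dvdn_pmul2r ?expn_gt0 //.
by rewrite dvdn2.
Qed.

Lemma dvdS_nbit v k : 2 ^ k %| v.+1 -> (2 ^ k.+1 %| v.+1) = nbit v k.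
Proof. by move=> h; rewrite dvd_nbit // nbitS h negbK. Qed.

Lemma dvd_logn v k : (2 ^ k %| v.+1) = (k <= logn 2 v.+1).
Proof. by rewrite pfactor_dvdn. Qed.

Definition upd (v : nat -> nat) (r a : nat) : nat -> nat :=
  fun k => if k == r then a else v k.

Fixpoint digs (v k : nat) : seq bool := if k is k'.+1 then nbit v k' :: digs v k' else [::].

Lemma nbit_half v k : nbit v k.+1 = nbit v./2 k.
Proof. by rewrite /nbit expnS divnMA divn2. Qed.

Lemma digs_rcons v k : digs v k.+1 = rcons (digs v./2 k) (odd v).
Proof.
elim: k => [|k IH]; first by rewrite /= /nbit expn0 divn1.
by rewrite -[LHS]/(nbit v k.+1 :: digs v k.+1) IH nbit_half.
Qed.

(** Ties the digit string of the encoding to the bits on the tape. The number 0 fits because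
    [trunc_log 2 0 = 0] leaves a single digit. *)
Lemma bin_digs v : bin v = digs v (trunc_log 2 v).+1.
Proof.
rewrite /bin; case: eqP => [->|/eqP]; first by rewrite trunc_log0 /= nbit0.
rewrite -lt0n => v0; have /andP[] := trunc_log_bounds (isT : 1 < 2) v0.
move: (trunc_log 2 v) => k.
suff gen f : v <= f -> 2 ^ k <= v -> v < 2 ^ k.+1 -> bin_aux f v = digs v k.+1 by apply: gen.
elim: f v k v0 => [|f IH] v k v0 vf; first lia.
case: v v0 vf => // v _ vf h1 h2; rewrite /= -[RHS]/(digs v.+1 k.+1) digs_rcons; congr rcons.
case: k h1 h2 => [|k] h1 h2.
  by have -> : v = 0 by [lia]; case: (f).
rewrite !expnS in h1 h2; apply: IH; rewrite ?expnS; lia.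
Qed.

Section Counters.
Variable m : nat.

(* A cell holds a mark (set only on cell 0), a flag recording that the cell has
   been used, and one bit of each of the m counters (least significant bit in
   cell 0). *)
Definition alph : finType := (bool * bool * {ffun 'I_m -> bool})%type.

Definition bit (r : nat) (g : alph) : bool := if insub r is Some k then g.2 k else false.
Definition mark (g : alph) : bool := g.1.1.
Definition used (g : alph) : bool := g.1.2.
Definition setbit (r : nat) (b : bool) (g : alph) : alph :=
  (g.1, [ffun k : 'I_m => if k == r :> nat then b else g.2 k]).
Definition setused (g : alph) : alph := (g.1.1, true, g.2).
Definition blk : alph := (false, false, [ffun=> false]).

Lemma bit_set r r' b g : r < m -> bit r' (setbit r b g) = if r' == r then b else bit r' g.
Proof.
rewrite /bit /setbit /= => hr; case: insubP => [k _ <-|]; first by rewrite ffunE.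
by case: eqP => // ->; rewrite hr.
Qed.

Lemma mark_set r b g : mark (setbit r b g) = mark g. Proof. by []. Qed.
Lemma used_set r b g : used (setbit r b g) = used g. Proof. by []. Qed.
Lemma bit_used r g : bit r (setused g) = bit r g. Proof. by []. Qed.
Lemma mark_used g : mark (setused g) = mark g. Proof. by []. Qed.
Lemma used_used g : used (setused g) = true. Proof. by []. Qed.
Definition cellE := (mark_set, used_set, bit_used, mark_used, used_used).

Variables (x : seq bool) (B : nat).

Record rep (vis : nat) (tp : nat -> alph) (v : nat -> nat) : Prop := Rep {
  rep_bit : forall k r, r < m -> bit r (tp k) = nbit (v r) k;
  rep_mark : forall k, mark (tp k) = (k == 0);
  rep_used : forall k, used (tp k) = (k < vis);
  rep_lt : forall r, r < m -> v r < 2 ^ vis;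
  rep_vis : vis <= B }.

Definition rst : Type := ((nat -> nat) * nat * seq bool)%type.

(** The head starts and ends on cell 0 and the tape is known only through its counters, so that
    machines compose at the level of counter values. *)
Definition rexecb (M : mach alph) (s : rst) (b : bool) (s' : rst) : Prop :=
  s.1.2 <= size x -> forall tp vis, rep vis tp s.1.1 -> exists tp' vis',
  [/\ rep vis' tp' s'.1.1, s'.1.2 <= size x &
      exec x B M (s.1.2, tp, 0, s.2) b (s'.1.2, tp', 0, s'.2)].

Definition rexec M s s' := exists b, rexecb M s b s'.

Lemma rexec_if T M1 M2 s b s1 s' :
  rexecb T s b s1 -> rexec (if b then M1 else M2) s1 s' -> rexec (ifm T M1 M2) s s'.
Proof.
move=> H1 [b' H2]; exists b' => hi tp vis /H1 -/(_ hi) [tp1 [vis1 [/H2 h2 hi1 e1]]].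
have [tp2 [vis2 [r2 hi2 e2]]] := h2 hi1.
by exists tp2, vis2; split=> //; apply: exec_if e1 _; case: (b) e2.
Qed.

Lemma rexec_seq M1 M2 s s1 s' : rexec M1 s s1 -> rexec M2 s1 s' -> rexec (seqm M1 M2) s s'.
Proof. by case=> b H1 H2; apply: rexec_if H1 _; case: b. Qed.

Lemma rexec_while0 T M s s' : rexecb T s false s' -> rexecb (whilem T M) s false s'.
Proof.
move=> H hi tp vis /H -/(_ hi) [tp1 [vis1 [r1 hi1 e1]]].
by exists tp1, vis1; split=> //; apply: exec_while0.
Qed.

Lemma rexec_while1 T M s s1 s2 s' : rexecb T s true s1 -> rexec M s1 s2 ->
  rexecb (whilem T M) s2 false s' -> rexecb (whilem T M) s false s'.
Proof.
move=> H1 [b H2] H3 hi tp vis /H1 -/(_ hi) [tp1 [vis1 [/H2 h2 hi1 e1]]].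
have [tp2 [vis2 [/H3 h3 hi2 e2]]] := h2 hi1.
have [tp3 [vis3 [r3 hi3 e3]]] := h3 hi2.
by exists tp3, vis3; split=> //; apply: exec_while1 e1 e2 e3.
Qed.

Definition goleft : mach alph :=
  whilem (test (fun _ g => ~~ mark g)) (put id MStay MLeft None).

Lemma exec_goleft i tp j o : (forall k, mark (tp k) = (k == 0)) -> i <= size x -> j <= B ->
  exec x B goleft (i, tp, j, o) false (i, tp, 0, o).
Proof.
move=> hm hi; elim: j => [|j IH] hj.
  by apply: exec_while0; apply: exec_test; rewrite // hm.
apply: (exec_while1 (s1 := (i, tp, j.+1, o)) (s2 := (i, tp, j, o)) (b := true)).
- by apply: exec_test => //; rewrite hm.
- apply: exec_put => //=; [exact: ltnW|exact: minn_idPl| |exact: cats0].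
  by move=> k; case: eqP => [->|].
- by apply: IH; apply: ltnW.
Qed.

Definition retset r : mach alph :=
  whilem (test (fun _ g => ~~ mark g))
    (seqm (put id MStay MLeft None) (put (setbit r true) MStay MStay None)).

Lemma exec_retset r i tp j o : (forall k, mark (tp k) = (k == 0)) -> i <= size x -> j <= B ->
  exec x B (retset r) (i, tp, j, o) false
    (i, fun k => if k < j then setbit r true (tp k) else tp k, 0, o).
Proof.
move=> hm hi; elim: j tp hm => [|j IH] tp hm hj.
  by apply: exec_while0; apply: exec_test; rewrite // hm.
pose tp1 := fun k => if k == j then setbit r true (tp k) else tp k.
apply: (exec_while1 (s1 := (i, tp, j.+1, o)) (s2 := (i, tp1, j, o)) (b := true)).
- by apply: exec_test => //; rewrite hm.
- apply: (exec_seq (s1 := (i, tp, j, o)) (b := true)).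
    apply: exec_put => //=; [exact: ltnW|exact: minn_idPl| |exact: cats0].
    by move=> k; case: eqP => [->|].
  apply: exec_put => //=; [exact: ltnW|exact: ltnW|exact: minn_idPl| |exact: cats0].
  by move=> k; rewrite /tp1; case: eqP => [->|].
- have -> : (fun k => if k < j.+1 then setbit r true (tp k) else tp k) =
            (fun k => if k < j then setbit r true (tp1 k) else tp1 k).
    apply: functional_extensionality => k; rewrite /tp1 ltnS leq_eqVlt.
    by case: eqP => [->|] //=; rewrite ltnn.
  apply: IH; last exact: ltnW.
  by move=> k; rewrite /tp1; case: eqP => // ->; rewrite !cellE.
Qed.

Definition incm r : mach alph :=
  seqm (whilem (test (fun _ g => bit r g)) (put (setbit r false) MStay MRight None))
  (seqm (put (fun g => setused (setbit r true g)) MStay MStay None) goleft).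

Lemma rexec_inc r v i o : r < m -> v r + 1 < 2 ^ B ->
  rexec (incm r) (v, i, o) (upd v r (v r + 1), i, o).
Proof.
move=> hr hv; exists false; rewrite /rexecb /= => hi tp vis R.
(* The carry stops after the trailing ones of [v r]; their number is the 2-adic valuation of
   [v r + 1]. *)
set p := logn 2 (v r).+1.
have hp : 2 ^ p <= (v r).+1 by apply: dvdn_leq => //; rewrite pfactor_dvdn.
have pB : p < B by rewrite -(ltn_exp2l _ _ (isT : 1 < 2)); lia.
have hb k : k < p -> nbit (v r) k.
  by move=> hk; rewrite -dvdS_nbit dvd_logn -/p //; apply: ltnW.
have hbp : nbit (v r) p = false by rewrite -dvdS_nbit dvd_logn -/p ?ltnn ?leqnn.
pose T k := fun c => if c < k then setbit r false (tp c) else tp c.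
pose tp' := fun c => if c == p then setused (setbit r true (T p c)) else T p c.
have pv : p <= vis.
  rewrite leqNgt; apply/negP => /hb; rewrite nbit_big //; exact: rep_lt R _ hr.
have vB := rep_vis R.
exists tp', (maxn vis p.+1); split=> //.
- split.
  + move=> k r' hr'; rewrite /tp' /T /upd addn1 /=.
    case: (eqVneq r' r) => [->|ne].
      rewrite ?eqxx nbitS dvd_logn -/p; case: (ltngtP k p) => [lt|gt|->].
      * by rewrite bit_set // eqxx hb.
      * by rewrite (rep_bit R).
      * by rewrite ?ltnn bit_used bit_set // eqxx hbp.
    rewrite -(rep_bit R) //; case: (ltngtP k p) => [lt|gt|->]; rewrite ?ltnn //=.
      by rewrite bit_set // (negbTE ne).
    by rewrite bit_used bit_set // (negbTE ne).
  + by move=> k; rewrite /tp' /T; case: (ltngtP k p) => [lt|gt|->]; rewrite ?ltnn ?cellE (rep_mark R).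
  + move=> k; rewrite /tp' /T; case: (ltngtP k p) => [lt|gt|->]; rewrite ?ltnn ?cellE ?(rep_used R); lia.
  + move=> r' hr'; rewrite /upd /=.
    have h : 2 ^ vis <= 2 ^ maxn vis p.+1 by rewrite leq_exp2l // leq_maxl.
    case: (eqVneq r' r) => [_|_]; last exact: leq_trans (rep_lt R hr') h.
    (* If [v r + 1] reaches [2 ^ vis], its valuation is [vis]: the carry stops in the fresh cell
       [vis], which has just become used. *)
    have /= := rep_lt R hr; rewrite leq_eqVlt -addn1 => /orP[/eqP e|]; last by move/leq_trans; apply.
    apply: (leq_ltn_trans (eq_leq e)); rewrite ltn_exp2l // leq_max; apply/orP; right.
    suff -> : p = vis by []; rewrite /p -[(v r).+1]addn1 e pfactorK //.
  + by rewrite geq_max vB.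
apply: (exec_seq (s1 := (i, T p, p, o)) (b := false)).
  have -> : tp = T 0 by apply: functional_extensionality.
  suff loop d k : k + d = p ->
    exec x B (whilem (test (fun _ g => bit r g)) (put (setbit r false) MStay MRight None))
      (i, T k, k, o) false (i, T p, p, o) by apply: (loop p).
  elim: d k => [|d IH] k e.
    have -> : k = p by lia.
    apply: exec_while0; apply: exec_test => //; first lia.
    by rewrite /T ltnn (rep_bit R).
  apply: (exec_while1 (s1 := (i, T k, k, o)) (s2 := (i, T k.+1, k.+1, o)) (b := true)).
  - apply: exec_test; rewrite // ?/T ?ltnn ?(rep_bit R) ?hb //; lia.
  - apply: exec_put; rewrite /= ?cats0 //; try lia.
    by move=> c; rewrite /T ltnS; case: (ltngtP c k) => [||->]; rewrite ?ltnn.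
  - by apply: IH; lia.
apply: (exec_seq (s1 := (i, tp', p, o)) (b := true)).
  apply: exec_put; rewrite /= ?cats0 //; try lia.
  by move=> c; rewrite /tp'; case: eqP => // ->.
apply: exec_goleft => //; last lia.
by move=> k; rewrite /tp' /T; case: (ltngtP k p) => [lt|gt|->]; rewrite ?ltnn ?cellE (rep_mark R).
Qed.

(* Exits with [false], changing nothing, when counter [r] is zero. *)
Definition decm r : mach alph :=
  seqm (whilem (test (fun _ g => used g && ~~ bit r g)) (put id MStay MRight None))
  (ifm (test (fun _ g => bit r g))
    (seqm (put (setbit r false) MStay MStay None)
       (seqm (retset r) (put id MStay MStay None)))
    goleft).

Lemma exec_scan r i tp o p : i <= size x -> p <= B ->
  (forall k, k < p -> used (tp k) && ~~ bit r (tp k)) -> used (tp p) && ~~ bit r (tp p) = false ->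
  exec x B (whilem (test (fun _ g => used g && ~~ bit r g)) (put id MStay MRight None))
    (i, tp, 0, o) false (i, tp, p, o).
Proof.
move=> hi pB hlt hp.
suff loop d k : k + d = p ->
    exec x B (whilem (test (fun _ g => used g && ~~ bit r g)) (put id MStay MRight None))
      (i, tp, k, o) false (i, tp, p, o) by apply: (loop p).
elim: d k => [|d IH] k e.
  have -> : k = p by lia.
  by apply: exec_while0; apply: exec_test.
apply: (exec_while1 (s1 := (i, tp, k, o)) (s2 := (i, tp, k.+1, o)) (b := true)).
- apply: exec_test; rewrite // ?hlt //; lia.
- apply: exec_put; rewrite /= ?cats0 //; try lia.
  by move=> c; case: eqP => [->|].
- by apply: IH; lia.
Qed.

Lemma rexec_dec0 r v i o : r < m -> v r = 0 -> rexecb (decm r) (v, i, o) false (v, i, o).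
Proof.
move=> hr v0; rewrite /rexecb /= => hi tp vis R; exists tp, vis; split=> //.
have vB := rep_vis R.
apply: (exec_seq (s1 := (i, tp, vis, o)) (b := false)).
  apply: exec_scan => //.
    by move=> k hk; rewrite (rep_used R) hk (rep_bit R) // v0 nbit0.
  by rewrite (rep_used R) ltnn.
apply: (exec_if (s1 := (i, tp, vis, o)) (b := false)).
  by apply: exec_test => //; rewrite (rep_bit R) // v0 nbit0.
by apply: exec_goleft => //; exact: rep_mark R.
Qed.

Lemma rexec_dec r v i o a : r < m -> v r = a.+1 ->
  rexecb (decm r) (v, i, o) true (upd v r a, i, o).
Proof.
move=> hr va; rewrite /rexecb /= => hi tp vis R.
have vB := rep_vis R.
(* The lowest 1 of a + 1 sits at its 2-adic valuation; the bits of a follow from [nbitS] read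
   backwards. *)
set p := logn 2 a.+1.
have hp : 2 ^ p <= a.+1 by apply: dvdn_leq => //; rewrite pfactor_dvdn.
have pv : p < vis.
  by rewrite -(ltn_exp2l _ _ (isT : 1 < 2)); apply: leq_ltn_trans hp _; rewrite -va; apply: rep_lt R _ hr.
have hb k : k < p -> nbit a.+1 k = false.
  by move=> hk; apply/negbTE; rewrite -dvd_nbit dvd_logn -/p //; apply: ltnW.
have hbp : nbit a.+1 p by rewrite -[nbit _ _]negbK -dvd_nbit dvd_logn -/p ?ltnn ?leqnn.
pose tp1 := fun c => if c == p then setbit r false (tp c) else tp c.
pose tp' := fun c => if c < p then setbit r true (tp1 c) else tp1 c.
have mk1 k : mark (tp1 k) = (k == 0).
  by rewrite /tp1; case: eqP => _; rewrite ?cellE (rep_mark R).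
exists tp', vis; split=> //.
- split=> //.
  + move=> k r' hr'; rewrite /tp' /tp1 /upd /=.
    case: (eqVneq r' r) => [->|ne].
      have := nbitS a k; rewrite dvd_logn -/p ?eqxx.
      case: (ltngtP k p) => [lt|gt|->]; rewrite ?ltnn ?eqxx ?bit_set ?eqxx // ?(rep_bit R) // ?va.
      * by rewrite hb //; case: (nbit a _).
      * by move=> ->.
      * by rewrite hbp; case: (nbit a _).
    rewrite -(rep_bit R) //; case: (ltngtP k p) => [lt|gt|->]; rewrite ?ltnn //=;
      by rewrite bit_set // (negbTE ne).
  + by move=> k; rewrite /tp'; case: (k < p); rewrite ?cellE mk1.
  + by move=> k; rewrite /tp' /tp1; case: (ltngtP k p) => [lt|gt|->]; rewrite ?ltnn ?cellE ?(rep_used R).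
  + move=> r' hr'; rewrite /upd /=; have := rep_lt R hr'.
    by case: (eqVneq r' r) => [->|//]; rewrite /= va; apply: ltn_trans.
apply: (exec_seq (s1 := (i, tp, p, o)) (b := false)).
  apply: exec_scan => //; first lia.
    by move=> k hk; rewrite (rep_used R) (ltn_trans hk pv) (rep_bit R) //= va hb.
  by rewrite (rep_used R) pv (rep_bit R) // va hbp.
apply: (exec_if (s1 := (i, tp, p, o)) (b := true)).
  by apply: exec_test; rewrite ?(rep_bit R) //= ?va //; lia.
apply: (exec_seq (s1 := (i, tp1, p, o)) (b := true)).
  apply: exec_put; rewrite /= ?cats0 //; try lia.
  by move=> k; rewrite /tp1; case: eqP => [->|].
apply: (exec_seq (s1 := (i, tp', 0, o)) (b := false)).
  by apply: exec_retset => //; lia.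
(* [retset] exits with false; this idle action supplies the exit value true of a successful
   decrement. *)
apply: exec_put; rewrite /= ?cats0 //; try lia.
by move=> k; case: eqP => [->|].
Qed.

(* The leading 1 is the continuation bit of the self-delimiting code [encN]. *)
Definition digitm r : mach alph :=
  seqm (put id MStay MStay (Some true))
    (act (fun _ g => (true, (g, MStay, MStay, Some (bit r g))))).

Lemma exec_digit r i tp j o : i <= size x -> j <= B ->
  exec x B (digitm r) (i, tp, j, o) true (i, tp, j, o ++ [:: true; bit r (tp j)]).
Proof.
move=> hi hj.
apply: (exec_seq (s1 := (i, tp, j, o ++ [:: true])) (b := true)).
  apply: exec_put; rewrite //=; try lia.
  by move=> k; case: eqP => [->|].
apply: exec_act => //=; rewrite -catA (minn_idPl hi); congr (_, _, _, _).
by apply: functional_extensionality => k; case: eqP => [->|].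
Qed.

(** The encoding has no leading zeros, so the head walks back from the end of the used part to the
    top digit. The mark stops it at cell 0, which yields one digit for the number 0. Cell 0 is
    printed separately because the printing loop ends on the mark. *)
Definition outm r : mach alph :=
  seqm (whilem (test (fun _ g => used g)) (put id MStay MRight None))
  (seqm (whilem (test (fun _ g => ~~ bit r g && ~~ mark g)) (put id MStay MLeft None))
  (seqm (whilem (test (fun _ g => ~~ mark g)) (seqm (digitm r) (put id MStay MLeft None)))
  (seqm (digitm r)
  (seqm (put id MStay MStay (Some false)) (put id MStay MStay (Some false)))))).

Lemma rexec_out r v i o : r < m -> rexec (outm r) (v, i, o) (v, i, o ++ encN (v r)).
Proof.
move=> hr; exists true; rewrite /rexecb /= => hi tp vis R; exists tp, vis; split=> //.
have vB := rep_vis R.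
have idtp k c : (if k == c then tp c else tp k) = tp k by case: eqP => [->|].
apply: (exec_seq (s1 := (i, tp, vis, o)) (b := false)).
  suff loop d k : k + d = vis ->
    exec x B (whilem (test (fun _ g => used g)) (put id MStay MRight None))
      (i, tp, k, o) false (i, tp, vis, o) by apply: (loop vis).
  elim: d k => [|d IH] k e.
    have -> : k = vis by lia.
    by apply: exec_while0; apply: exec_test; rewrite ?(rep_used R) ?ltnn.
  apply: (exec_while1 (s1 := (i, tp, k, o)) (s2 := (i, tp, k.+1, o)) (b := true)).
  - apply: exec_test; rewrite ?(rep_used R) //; lia.
  - apply: exec_put; rewrite /= ?cats0 //; lia.
  - by apply: IH; lia.
set p := trunc_log 2 (v r).
have hp : v r < 2 ^ p.+1 by apply: trunc_log_ltn.
have pv : p <= vis.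
  case: (posnP (v r)) => [e|v0]; first by rewrite /p e trunc_log0.
  rewrite ltnW // -(ltn_exp2l _ _ (isT : 1 < 2)); apply: leq_ltn_trans (rep_lt R hr).
  exact: trunc_logP.
apply: (exec_seq (s1 := (i, tp, p, o)) (b := false)).
  suff loop d k : k = p + d -> k <= B ->
    exec x B (whilem (test (fun _ g => ~~ bit r g && ~~ mark g)) (put id MStay MLeft None))
      (i, tp, k, o) false (i, tp, p, o) by apply: (loop (vis - p)) => //; lia.
  elim: d k => [|d IH] k e kB.
    have -> : k = p by lia.
    apply: exec_while0; apply: exec_test; rewrite ?(rep_bit R) ?(rep_mark R) //; first lia.
    case: (posnP (v r)) => [e'|v0]; first by rewrite /p e' trunc_log0 andbF.
    suff -> : nbit (v r) p by [].
    rewrite /nbit; have := trunc_logP (isT : 1 < 2) v0; rewrite -/p => h.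
    have : v r %/ 2 ^ p < 2 by rewrite ltn_divLR ?expn_gt0 // -expnS.
    have : 0 < v r %/ 2 ^ p by rewrite divn_gt0 ?expn_gt0.
    by case: (_ %/ _) => [|[|]].
  apply: (exec_while1 (s1 := (i, tp, k, o)) (s2 := (i, tp, k.-1, o)) (b := true)).
  - apply: exec_test; rewrite ?(rep_bit R) ?(rep_mark R) //.
    rewrite nbit_big /=; first lia.
    by apply: leq_trans hp _; rewrite leq_exp2l //; lia.
  - apply: exec_put; rewrite /= ?cats0 //; lia.
  - by apply: IH; lia.
have -> : encN (v r) = flatten [seq [:: true; d] | d <- digs (v r) p.+1] ++ [:: false; false].
  by rewrite /encN bin_digs.
(* [o'] is the output just before the digit of cell 0. *)
have [o' [Ho' E']] : exists o', o' ++ [:: true; nbit (v r) 0] =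
     o ++ flatten [seq [:: true; d] | d <- digs (v r) p.+1] /\
   exec x B (whilem (test (fun _ g => ~~ mark g)) (seqm (digitm r) (put id MStay MLeft None)))
     (i, tp, p, o) false (i, tp, 0, o').
  have {pv} : p <= B by lia.
  move: (p) (o) => {p hp o}; elim=> [|k IH] o kB.
    by exists o; split=> //; apply: exec_while0; apply: exec_test; rewrite // (rep_mark R).
  have [o' [Ho' E']] := IH (o ++ [:: true; nbit (v r) k.+1]) (ltnW kB).
  exists o'; split; first by rewrite Ho' -catA.
  apply: (exec_while1 (s1 := (i, tp, k.+1, o))
    (s2 := (i, tp, k, o ++ [:: true; nbit (v r) k.+1])) (b := true)) => //.
    by apply: exec_test; rewrite // (rep_mark R).
  rewrite -(rep_bit R) //; apply: (exec_seq (exec_digit r tp o hi kB)).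
  by apply: exec_put; rewrite /= ?cats0 //; lia.
apply: (exec_seq E'); apply: (exec_seq (exec_digit r tp o' hi (leq0n B))).
rewrite (rep_bit R) // Ho' catA.
set o1 := o ++ _.
apply: (exec_seq (s1 := (i, tp, 0, o1 ++ [:: false])) (b := true)).
  by apply: exec_put; rewrite //=; lia.
by apply: exec_put; rewrite /= -?catA //; lia.
Qed.

Lemma rep_blk : rep 0 (fun k => if k == 0 then (true, false, [ffun=> false]) else blk) (fun=> 0).
Proof.
split=> //.
- by move=> k r hr; rewrite nbit0; case: eqP => _; rewrite /bit; case: insubP => //= ? _ _; rewrite ffunE.
- by move=> k; case: eqP.
- by move=> k; case: eqP.
Qed.

End Counters.

(** * Arithmetic expressions *)

(* [EDiv a b] denotes a / (b + 1), so that no division by zero can occur. *)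
Inductive expr :=
| EConst of nat | EVar of bool | EAdd of expr & expr | ESub of expr & expr
| EMul of expr & expr | EDiv of expr & expr | EInp of expr.

Definition rdcode (r : option bool) : nat :=
  match r with None => 0 | Some false => 1 | Some true => 2 end.

Fixpoint eval (x : seq bool) (env : bool -> nat) (e : expr) : nat :=
  match e with
  | EConst c => c
  | EVar b => env b
  | EAdd a b => eval x env a + eval x env b
  | ESub a b => eval x env a - eval x env b
  | EMul a b => eval x env a * eval x env b
  | EDiv a b => eval x env a %/ (eval x env b).+1
  | EInp a => rdcode (rd x (minn (eval x env a) (size x)))
  end.

(* Bounds every value that a counter takes while [e] is evaluated on variables at
   most [b], which is why subtraction and division do not decrease it. *)
Fixpoint bnd (e : expr) (b : nat) : nat :=
  match e with
  | EConst c => c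
  | EVar _ => b
  | EAdd e1 e2 | ESub e1 e2 => bnd e1 b + bnd e2 b
  | EMul e1 e2 => (bnd e1 b).+1 * (bnd e2 b).+1
  | EDiv e1 e2 => (bnd e1 b + bnd e2 b).+1
  | EInp e1 => bnd e1 b + 2
  end.

Fixpoint scratch (e : expr) : nat :=
  match e with
  | EConst _ => 1
  | EVar _ => 2
  | EAdd e1 e2 | ESub e1 e2 | EMul e1 e2 | EDiv e1 e2 => scratch e1 + scratch e2 + 4
  | EInp e1 => scratch e1 + 2
  end.

Lemma scratch_gt0 e : 0 < scratch e.
Proof. by elim: e => //= *; rewrite addnS. Qed.

Lemma eval_bnd x env e b : (forall c, env c <= b) -> eval x env e <= bnd e b.
Proof.
move=> h; elim: e => //=; try lia.
- by move=> e1 h1 e2 h2; rewrite leq_mul //; lia.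
- by move=> e1 h1 e2 h2; apply: leq_trans (leq_div _ _) _; lia.
- by move=> e1 h1; case: rd => [[]|] /=; lia.
Qed.

(** * Compilation of expressions to counter machines *)

Section Compile.
Variables (m : nat).
Notation alph := (alph m).
Notation incm := (@incm m).
Notation decm := (@decm m).

Definition skip : mach alph := put id MStay MStay None.
Definition ihR : mach alph := put id MRight MStay None.
Definition ihL : mach alph := put id MLeft MStay None.
Definition intest (P : option bool -> bool) : mach alph := test (fun r _ => P r).
Definition loopm r (M : mach alph) : mach alph := whilem (decm r) M.

(* Puts the value of the expression in counter [d]; counters 0 and 1 hold the two
   variables, and the counters above [d] are scratch space, zero before and after. *)
Fixpoint cexp (e : expr) (d : nat) : mach alph :=
  match e with
  | EConst c => iter c (fun M => seqm (incm d) M) skip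
  | EVar b => seqm (loopm b (seqm (incm d) (incm d.+1))) (loopm d.+1 (incm b))
  | EAdd e1 e2 => seqm (cexp e1 d) (seqm (cexp e2 d.+1) (loopm d.+1 (incm d)))
  | ESub e1 e2 => seqm (cexp e1 d) (seqm (cexp e2 d.+1) (loopm d.+1 (decm d)))
  | EMul e1 e2 =>
      seqm (cexp e1 d.+1) (seqm (cexp e2 d.+2)
      (seqm (loopm d.+1 (seqm (loopm d.+2 (seqm (incm d) (incm d.+3)))
                              (loopm d.+3 (incm d.+2))))
            (loopm d.+2 skip)))
  | EDiv e1 e2 =>
      seqm (cexp e1 d.+1) (seqm (cexp e2 d.+2) (seqm (incm d.+2)
      (seqm (loopm d.+1 (seqm (decm d.+2) (seqm (incm d.+3)
               (ifm (decm d.+2) (incm d.+2)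
                    (seqm (loopm d.+3 (incm d.+2)) (incm d))))))
      (seqm (loopm d.+2 skip) (loopm d.+3 skip)))))
  | EInp e1 =>
      seqm (cexp e1 d) (seqm (loopm d (seqm (incm d.+1) ihR))
      (seqm (ifm (intest (fun r => r == Some true)) (seqm (incm d) (incm d))
             (ifm (intest (fun r => r == Some false)) (incm d) skip))
            (loopm d.+1 ihL)))
  end.

Variables (x : seq bool) (B : nat).
Notation rexec := (@rexec m x B).
Notation rexecb := (@rexecb m x B).

Lemma rexec_put mi v i o i' : minn (mv mi i) (size x) = i' ->
  rexec (put id mi MStay None) (v, i, o) (v, i', o).
Proof.
move=> hi'; exists true; rewrite /rexecb /= => hi tp vis R.
exists tp, vis; split=> //; first by rewrite -hi' geq_minr.
by apply: exec_put; rewrite /= ?cats0 // => k; case: eqP => [->|].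
Qed.

Lemma rexec_skip v i o : i <= size x -> rexec skip (v, i, o) (v, i, o).
Proof. by move=> hi; apply: rexec_put; apply/minn_idPl. Qed.

Lemma rexec_intest P v i o : rexecb (intest P) (v, i, o) (P (rd x i)) (v, i, o).
Proof.
by rewrite /rexecb /= => hi tp vis R; exists tp, vis; split=> //; apply: exec_test.
Qed.

Lemma rexec_inc' r v v' i o : r < m -> v r + 1 < 2 ^ B -> v' = upd v r (v r + 1) ->
  rexec (incm r) (v, i, o) (v', i, o).
Proof. by move=> hr hv ->; apply: rexec_inc. Qed.

Lemma rexec_dec' r v v' i o : r < m -> v' = upd v r (v r - 1) ->
  rexec (decm r) (v, i, o) (v', i, o).
Proof.
move=> hr ->; case E: (v r) => [|a].
  have -> : upd v r (0 - 1) = v.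
    by apply: functional_extensionality => k; rewrite /upd; case: eqP => // ->.
  by exists false; apply: rexec_dec0.
by exists true; rewrite subn1 /=; apply: rexec_dec.
Qed.

(** [S a] is the state with a rounds left. [decm] acts before the body, which therefore starts from
    [S a.+1] with the loop counter already lowered to a. *)
Lemma rexec_loop r M (S : nat -> rst) A s s' : r < m -> S A = s -> S 0 = s' ->
  (forall a, (S a).1.1 r = a) ->
  (forall a, a < A -> rexec M (upd (S a.+1).1.1 r a, (S a.+1).1.2, (S a.+1).2) (S a)) ->
  rexec (loopm r M) s s'.
Proof.
move=> hr <- <- hS hM; exists false; elim: A hM => [|A IH] hM.
  apply: rexec_while0.
  have := @rexec_dec0 m x B r (S 0).1.1 (S 0).1.2 (S 0).2 hr (hS 0).
  by rewrite -!surjective_pairing.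
apply: (rexec_while1 (s1 := (upd (S A.+1).1.1 r A, (S A.+1).1.2, (S A.+1).2)) (s2 := S A)).
- have := @rexec_dec m x B r (S A.+1).1.1 (S A.+1).1.2 (S A.+1).2 A hr (hS _).
  by rewrite -!surjective_pairing.
- exact: hM.
- by apply: IH => a ha; apply: hM; apply: ltnW.
Qed.

Ltac upd_solve Hz :=
  let kk := fresh in apply: functional_extensionality => kk; rewrite /upd /=;
  repeat (case: eqP => ?; try subst kk); try first [lia | by rewrite !Hz; lia].

Ltac upd_val Hz := rewrite /upd /= ?eqxx; repeat (case: eqP => ?; try lia); try first [lia | by rewrite !Hz; lia].

Lemma rexec_clear r v v' i o : r < m -> i <= size x -> v' = upd v r 0 ->
  rexec (loopm r skip) (v, i, o) (v', i, o).
Proof.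
move=> hr hi ->; apply: (rexec_loop (S := fun a => (upd v r a, i, o)) (A := v r)) => //.
- congr (_, _, _); upd_solve True.
- by move=> a; rewrite /upd /= eqxx.
- move=> a _ /=; have -> : upd (upd v r a.+1) r a = upd v r a by upd_solve True.
  exact: rexec_skip.
Qed.

(** Every intermediate counter value is at most [bnd e b], so no increment leaves the [B] available
    bits. The destination is general in the induction because subexpressions go to higher
    counters. *)
Lemma cexp_ok e d v o env b : v 0 = env false -> v 1 = env true ->
  (forall c, env c <= b) -> 2 <= d -> d + scratch e <= m ->
  (forall k, d <= k -> v k = 0) -> bnd e b < 2 ^ B ->
  rexec (cexp e d) (v, 0, o) (upd v d (eval x env e), 0, o).
Proof.
move=> v0 v1 henv; elim: e d v v0 v1 => [c|c|e1 IH1 e2 IH2|e1 IH1 e2 IH2|e1 IH1 e2 IH2|e1 IH1 e2 IH2|e1 IH1]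
  d v v0 v1 hd hm Hz hb /=; rewrite /= in hm hb;
  try (have := eval_bnd x e1 henv; move: (eval x env e1) (IH1) => A {}IH1 hA);
  try (have := eval_bnd x e2 henv; move: (eval x env e2) (IH2) => C {}IH2 hC).
- suff H k : k <= c -> rexec (iter k (fun M => seqm (incm d) M) skip)
     (upd v d (c - k), 0, o) (upd v d c, 0, o).
    have := H c (leqnn c); rewrite subnn.
    by have -> : upd v d 0 = v by upd_solve Hz.
  elim: k => [|k IH] hk /=; first by rewrite subn0; apply: rexec_skip.
  apply: rexec_seq (IH (ltnW hk)).
  apply: rexec_inc'; [lia|upd_val Hz|upd_solve Hz].
- have hc : env c = v c by case: (c).
  have cd : c < d by case: (c); lia.
  (* Reading a counter drains it, so the value goes to [d] and to a copy in [d.+1] that restores the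
     variable. *)
  apply: (rexec_seq (s1 := (upd (upd (upd v c 0) d (env c)) d.+1 (env c), 0, o))).
    apply: (rexec_loop (S := fun a => (upd (upd (upd v c a) d (env c - a)) d.+1 (env c - a), 0, o)) (A := env c)).
    + lia.
    + congr (_, _, _); upd_solve Hz.
    + by rewrite subn0.
    + move=> a; upd_val Hz.
    + move=> a ha /=.
      apply: (rexec_seq (s1 := (upd (upd (upd v c a) d (env c - a)) d.+1 (env c - a.+1), 0, o))).
        apply: rexec_inc'; [lia|upd_val Hz|upd_solve Hz].
        have := henv c; lia.
      apply: rexec_inc'; [lia|upd_val Hz|upd_solve Hz].
      have := henv c; lia.
  apply: (rexec_loop (S := fun a => (upd (upd (upd v c (env c - a)) d (env c)) d.+1 a, 0, o)) (A := env c)).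
  + lia.
  + congr (_, _, _); upd_solve Hz.
  + congr (_, _, _); upd_solve Hz.
  + move=> a; upd_val Hz.
  + move=> a ha /=; apply: rexec_inc'; [lia|upd_val Hz|upd_solve Hz].
    have := henv c; lia.
- have [s1 s2] := (scratch_gt0 e1, scratch_gt0 e2).
  apply: (rexec_seq (s1 := (upd v d A, 0, o))).
    by apply: IH1 => //; lia.
  apply: (rexec_seq (s1 := (upd (upd v d A) d.+1 C, 0, o))).
    by apply: IH2; [upd_val Hz|upd_val Hz|lia|lia|move=> k ?; upd_val Hz|lia].
  apply: (rexec_loop (S := fun a => (upd (upd v d (A + (C - a))) d.+1 a, 0, o)) (A := C)).
  + lia.
  + congr (_, _, _); upd_solve Hz.
  + congr (_, _, _); upd_solve Hz.
  + move=> a; upd_val Hz.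
  + move=> a ha /=; apply: rexec_inc'; [lia|upd_val Hz|upd_solve Hz].
- have [s1 s2] := (scratch_gt0 e1, scratch_gt0 e2).
  apply: (rexec_seq (s1 := (upd v d A, 0, o))).
    by apply: IH1 => //; lia.
  apply: (rexec_seq (s1 := (upd (upd v d A) d.+1 C, 0, o))).
    by apply: IH2; [upd_val Hz|upd_val Hz|lia|lia|move=> k ?; upd_val Hz|lia].
  apply: (rexec_loop (S := fun a => (upd (upd v d (A - (C - a))) d.+1 a, 0, o)) (A := C)).
  + lia.
  + congr (_, _, _); upd_solve Hz.
  + congr (_, _, _); upd_solve Hz.
  + move=> a; upd_val Hz.
  + move=> a ha /=; apply: rexec_dec'; [lia|upd_solve Hz].
- have [s1 s2] := (scratch_gt0 e1, scratch_gt0 e2).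
  have hAC : A * C + A + C < 2 ^ B.
    by apply: leq_ltn_trans hb; apply: leq_trans (_ : A.+1 * C.+1 <= _); [lia|rewrite leq_mul].
  (* The successors in the product bound keep each factor bounded even when the other one is 0. *)
  have [hbA hbC] : bnd e1 b < 2 ^ B /\ bnd e2 b < 2 ^ B by split; nia.
  apply: (rexec_seq (s1 := (upd v d.+1 A, 0, o))).
    by apply: IH1 => //; try lia; move=> k ?; rewrite Hz //; lia.
  apply: (rexec_seq (s1 := (upd (upd v d.+1 A) d.+2 C, 0, o))).
    by apply: IH2; [upd_val Hz|upd_val Hz|lia|lia|move=> k ?; upd_val Hz|lia].
  apply: (rexec_seq (s1 := (upd (upd v d (A * C)) d.+2 C, 0, o))).
    apply: (rexec_loop (S := fun a => (upd (upd (upd v d ((A - a) * C)) d.+1 a) d.+2 C, 0, o)) (A := A)).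
    + lia.
    + congr (_, _, _); upd_solve Hz.
    + congr (_, _, _); rewrite subn0; upd_solve Hz.
    + move=> a; upd_val Hz.
    + move=> a ha /=.
      have Q : (A - a) * C = (A - a.+1) * C + C by nia.
      have Q' : (A - a) * C <= A * C by nia.
      set P := (A - a.+1) * C in Q *.
      apply: (rexec_seq (s1 := (upd (upd (upd v d (P + C)) d.+1 a) d.+3 C, 0, o))).
        apply: (rexec_loop (S := fun u => (upd (upd (upd (upd v d (P + (C - u))) d.+1 a) d.+2 u) d.+3 (C - u), 0, o)) (A := C)).
        * lia.
        * congr (_, _, _); upd_solve Hz.
        * congr (_, _, _); upd_solve Hz.
        * move=> u; upd_val Hz.
        * move=> u hu /=.
          apply: (rexec_seq (s1 := (upd (upd (upd (upd v d (P + (C - u))) d.+1 a) d.+2 u) d.+3 (C - u.+1), 0, o))).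
            apply: rexec_inc'; [lia|upd_val Hz|upd_solve Hz].
          apply: rexec_inc'; [lia|upd_val Hz|upd_solve Hz].
      apply: (rexec_loop (S := fun u => (upd (upd (upd (upd v d (P + C)) d.+1 a) d.+2 (C - u)) d.+3 u, 0, o)) (A := C)).
      * lia.
      * congr (_, _, _); upd_solve Hz.
      * congr (_, _, _); rewrite ?Q; upd_solve Hz.
      * move=> u; upd_val Hz.
      * move=> u hu /=; apply: rexec_inc'; [lia|upd_val Hz|upd_solve Hz].
  by apply: rexec_clear; [lia| |upd_solve Hz].
- have [s1 s2] := (scratch_gt0 e1, scratch_gt0 e2).
  apply: (rexec_seq (s1 := (upd v d.+1 A, 0, o))).
    by apply: IH1 => //; try lia; move=> k ?; rewrite Hz //; lia.
  apply: (rexec_seq (s1 := (upd (upd v d.+1 A) d.+2 C, 0, o))).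
    by apply: IH2; [upd_val Hz|upd_val Hz|lia|lia|move=> k ?; upd_val Hz|lia].
  apply: (rexec_seq (s1 := (upd (upd v d.+1 A) d.+2 C.+1, 0, o))).
    apply: rexec_inc'; [lia|upd_val Hz|upd_solve Hz].
  (* Unary division: [d.+3] holds the remainder and [d.+2] its distance to the divisor. When the
     distance hits 0, the remainder is poured back and the quotient grows. *)
  pose q a := a %/ C.+1; pose r a := a %% C.+1.
  have rC a : r a <= C by rewrite -ltnS ltn_pmod.
  have qA a : q a <= a by apply: leq_div.
  pose V a p t u s := (upd (upd (upd (upd v d p) d.+1 a) d.+2 t) d.+3 u, 0, s) : rst.
  apply: (rexec_seq (s1 := V 0 (q A) (C.+1 - r A) (r A) o)).
    apply: (rexec_loop (S := fun a => V a (q (A - a)) (C.+1 - r (A - a)) (r (A - a)) o) (A := A)).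
    + lia.
    + rewrite subnn /V /q /r div0n mod0n; congr (_, _, _); upd_solve Hz.
    + by rewrite subn0.
    + move=> a; rewrite /V; upd_val Hz.
    + move=> a ha.
      have -> : A - a = (A - a.+1).+1 by lia.
      have : A - a.+1 < A by lia.
      move: (A - a.+1) => k hk.
      have [Qr Qq] : r k.+1 = (if r k == C then 0 else (r k).+1) /\ q k.+1 = q k + (r k == C).
        have E : k.+1 = q k * C.+1 + (r k).+1 by rewrite addnS -divn_eq.
        have Er : r k.+1 = (q k * C.+1 + (r k).+1) %% C.+1 by rewrite -E.
        have Eq : q k.+1 = (q k * C.+1 + (r k).+1) %/ C.+1 by rewrite -E.
        have rk := rC k; rewrite Er Eq; case: eqP => e'.
          by rewrite e' -mulSnr modnMl mulnK // addn1.
        rewrite modnMDl divnMDl // modn_small ?divn_small ?addn0 //; lia.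
      have [rk qk] := (rC k, qA k).
      apply: (rexec_seq (s1 := V a (q k) (C - r k) (r k) o)).
        rewrite /V; apply: rexec_dec'; [lia|upd_solve Hz].
      apply: (rexec_seq (s1 := V a (q k) (C - r k) (r k).+1 o)).
        rewrite /V; apply: rexec_inc'; [lia|upd_val Hz|upd_solve Hz].
      rewrite Qr Qq; case: eqP => e'.
        apply: (rexec_if (s1 := V a (q k) (C - r k) (r k).+1 o) (b := false)).
          rewrite /V; apply: rexec_dec0; [lia|upd_val Hz].
        apply: (rexec_seq (s1 := V a (q k) C.+1 0 o)).
          apply: (rexec_loop (S := fun u => V a (q k) (C.+1 - u) u o) (A := C.+1)).
          * lia.
          * by rewrite /V e' !subnn.
          * by rewrite subn0.
          * move=> u; rewrite /V; upd_val Hz.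
          * move=> u hu; rewrite /V; apply: rexec_inc'; [lia|upd_val Hz|upd_solve Hz].
        rewrite /V /=; apply: rexec_inc'; [lia|upd_val Hz|upd_solve Hz].
      apply: (rexec_if (s1 := V a (q k) (C - (r k).+1) (r k).+1 o) (b := true)).
        have -> : V a (q k) (C - (r k).+1) (r k).+1 o =
          (upd (V a (q k) (C - r k) (r k).+1 o).1.1 d.+2 (C - (r k).+1), 0, o).
          rewrite /V; congr (_, _, _); upd_solve Hz.
        rewrite /V; apply: rexec_dec; [lia|upd_val Hz].
      rewrite /V /= ?addn0; apply: rexec_inc'; [lia|upd_val Hz|upd_solve Hz].
  apply: (rexec_seq (s1 := V 0 (q A) 0 (r A) o)).
    by rewrite /V; apply: rexec_clear; [lia| |upd_solve Hz].
  by rewrite /V; apply: rexec_clear; [lia| |upd_solve Hz].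
- have s1 := scratch_gt0 e1.
  apply: (rexec_seq (s1 := (upd v d A, 0, o))).
    by apply: IH1 => //; lia.
  apply: (rexec_seq (s1 := (upd v d.+1 A, minn A (size x), o))).
    apply: (rexec_loop (S := fun a => (upd (upd v d a) d.+1 (A - a), minn (A - a) (size x), o)) (A := A)).
    + lia.
    + by rewrite subnn min0n; congr (_, _, _); upd_solve Hz.
    + by rewrite subn0; congr (_, _, _); upd_solve Hz.
    + move=> a; upd_val Hz.
    + move=> a ha /=.
      apply: (rexec_seq (s1 := (upd (upd v d a) d.+1 (A - a), minn (A - a.+1) (size x), o))).
        apply: rexec_inc'; [lia|upd_val Hz|upd_solve Hz].
      by apply: rexec_put => /=; lia.
  set R := rdcode _; set p := minn A _ in R *.
  have pn : p <= size x by rewrite geq_minr.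
  apply: (rexec_seq (s1 := (upd (upd v d R) d.+1 A, p, o))).
    apply: rexec_if (@rexec_intest _ _ _ _) _.
    case: eqP => [e'|ne].
      apply: (rexec_seq (s1 := (upd (upd v d 1) d.+1 A, p, o))).
        apply: rexec_inc'; [lia|upd_val Hz|upd_solve Hz].
      rewrite /R e' /=; apply: rexec_inc'; [lia|upd_val Hz|upd_solve Hz].
    apply: rexec_if (@rexec_intest _ _ _ _) _.
    move: ne; rewrite /R; case: rd => [[]|] //= _.
    + apply: rexec_inc'; [lia|upd_val Hz|upd_solve Hz].
    + have -> : upd (upd v d 0) d.+1 A = upd v d.+1 A by upd_solve Hz.
      exact: rexec_skip.
  (* Since p <= A, A moves to the left bring the input head back to 0; surplus moves are absorbed
     there. *)
  apply: (rexec_loop (S := fun a => (upd (upd v d R) d.+1 a, p - (A - a), o)) (A := A)).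
  + lia.
  + by rewrite subnn subn0.
  + by congr (_, _, _); [upd_solve Hz|lia].
  + move=> a; upd_val Hz.
  + move=> a ha /=.
    have -> : upd (upd (upd v d R) d.+1 a.+1) d.+1 a = upd (upd v d R) d.+1 a by upd_solve Hz.
    by apply: rexec_put => /=; lia.
Qed.
End Compile.

(** * Printing a circuit given by expressions *)

Definition envx (x : seq bool) (N : nat) (b : bool) : nat := if b then N else size x.

(** Descending names give a reverse topological order as soon as predecessors have smaller names. *)
Fixpoint gates (G : nat -> gate) (W : nat) : seq gate :=
  if W is W'.+1 then G W' :: gates G W' else [::].

Lemma size_gates G W : size (gates G W) = W.
Proof. by elim: W => //= W ->. Qed.

Record gate_family := Family {
  fam_out : expr; fam_size : expr; fam_kind : expr; fam_val : expr;
  fam_p1 : expr; fam_p2 : expr }.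

(* Kind 0 is an input gate, kind 1 a product gate, any other kind a quotient gate. *)
Definition fam_gate (F : gate_family) (x : seq bool) (N : nat) : gate :=
  let v e := eval x (envx x N) e in
  match v (fam_kind F) with
  | 0 => (N, LIn (v (fam_val F)), [::])
  | 1 => (N, LBin OTimes, [:: v (fam_p1 F); v (fam_p2 F)])
  | _ => (N, LBin ODiv, [:: v (fam_p1 F); v (fam_p2 F)])
  end.

Definition fam_width (F : gate_family) (x : seq bool) : nat := eval x (envx x 0) (fam_size F).

Definition fam_circuit (F : gate_family) (x : seq bool) : circuit :=
  (eval x (envx x 0) (fam_out F), gates (fam_gate F x) (fam_width F x)).

(** The base [n + 2] is at least 2, so constants and sums are absorbed by raising the exponent. *)
Lemma bnd_poly e k : exists K, forall n b, b <= (n + 2) ^ k -> bnd e b <= (n + 2) ^ K.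
Proof.
have X2 n : 1 < n + 2 by lia.
elim: e => /= [c|c|e1 [K1 h1] e2 [K2 h2]|e1 [K1 h1] e2 [K2 h2]|e1 [K1 h1] e2 [K2 h2]|e1 [K1 h1] e2 [K2 h2]|e1 [K1 h1]].
- by exists c => n b _; apply: ltnW; apply: ltn_expl.
- by exists k.
1-2: exists (K1 + K2).+1 => n b hb; move: (h1 n b hb) (h2 n b hb) => {}h1 {}h2;
  rewrite expnS expnD;
  have := expn_gt0 (n + 2) K1; have := expn_gt0 (n + 2) K2; rewrite !addn2 /= -addn2 => p2 p1;
  apply: leq_trans (leq_add h1 h2) _; nia.
- exists (K1 + K2).+2 => n b hb; move: (h1 n b hb) (h2 n b hb) => {}h1 {}h2.
  have -> : (K1 + K2).+2 = K1.+1 + K2.+1 by lia.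
  rewrite expnD; apply: leq_mul; rewrite expnS.
    have := expn_gt0 (n + 2) K1; rewrite !addn2 /= -addn2; nia.
  have := expn_gt0 (n + 2) K2; rewrite !addn2 /= -addn2; nia.
- exists (K1 + K2).+2 => n b hb; move: (h1 n b hb) (h2 n b hb) => {}h1 {}h2.
  rewrite !expnS expnD.
  have := expn_gt0 (n + 2) K1; have := expn_gt0 (n + 2) K2; rewrite !addn2 /= -addn2 => p2 p1.
  have h3 : (bnd e1 b + bnd e2 b).+1 <= 3 * ((n + 2) ^ K1 * (n + 2) ^ K2) by nia.
  by apply: leq_trans h3 _; rewrite (mulnA (n + 2)) leq_mul2r; apply/orP; right; nia.
- exists K1.+2 => n b hb; move: (h1 n b hb) => {}h1.
  rewrite !expnS.
  have := expn_gt0 (n + 2) K1; rewrite !addn2 /= -addn2; nia.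
Qed.

Lemma all_In (T : Type) (p : pred T) (s : seq T) (e : T) : all p s -> List.In e s -> p e.
Proof. by elim: s => //= a s IH /andP[pa ps] [<-|] //; apply: IH. Qed.

Lemma all_sumn (T : Type) (f : T -> nat) (s : seq T) : all (fun e => f e <= sumn (map f s)) s.
Proof.
elim: s => //= a s IH; rewrite leq_addr /=; apply: sub_all IH => e /leq_trans; apply.
exact: leq_addl.
Qed.

Section Program.
Variables (F : gate_family) (m : nat).
Notation alph := (alph m).
Notation incm := (@incm m).

Definition pr (e : expr) : mach alph :=
  seqm (cexp m e 2) (seqm (outm m 2) (loopm 2 (skip m))).

(** Operation labels are encoded as [2 + op_code], which is 6 for a product and 7 for a quotient;
    the truncated differences add 1 exactly for kinds of at least 2. *)
Definition e_label : expr :=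
  EAdd (EConst 6) (ESub (ESub (fam_kind F) (EConst 1)) (ESub (fam_kind F) (EConst 2))).

Definition pr_gate : mach alph :=
  seqm (pr (EVar true)) (seqm (cexp m (fam_kind F) 2)
   (ifm (decm m 2)
     (seqm (loopm 2 (skip m)) (seqm (pr e_label) (seqm (pr (EConst 2))
       (seqm (pr (fam_p1 F)) (pr (fam_p2 F))))))
     (seqm (pr (EConst 0)) (seqm (pr (fam_val F)) (pr (EConst 0)))))).

(** The detour through counter 1 returns the input head to 0 without losing the count of input
    cells. *)
Definition prologue : mach alph :=
  seqm (whilem (intest m isSome) (seqm (incm 0) (ihR m)))
  (seqm (loopm 0 (seqm (incm 1) (ihL m))) (loopm 1 (incm 0))).

(** Counter 1 is both the loop counter and the gate name. It is decremented before each gate, so the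
    body sees W - 1, ..., 0, the order of [gates]. The final 0 is the queried number. *)
Definition program : mach alph :=
  seqm (put (fun g : alph => (true, used g, g.2)) MStay MStay None)
  (seqm prologue (seqm (pr (fam_out F)) (seqm (pr (fam_size F))
  (seqm (cexp m (fam_size F) 2) (seqm (loopm 2 (incm 1))
  (seqm (loopm 1 pr_gate) (pr (EConst 0)))))))).

Definition fam_exprs : seq expr :=
  [:: fam_out F; fam_size F; fam_kind F; fam_val F; fam_p1 F; fam_p2 F; e_label;
      EConst 0; EConst 2; EVar true].

Variables (x : seq bool) (B : nat).
Notation rexec := (@rexec m x B).
Notation n := (size x).
Notation W := (fam_width F x).
Hypothesis scratch_m : all (fun e => 2 + scratch e <= m) fam_exprs.
Hypothesis bnd_B : all (fun e => bnd e (n + W).+1 < 2 ^ B) fam_exprs.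

Definition base (k N : nat) : nat -> nat := fun r => match r with 0 => k | 1 => N | _ => 0 end.

Lemma rexec_eval e N o : List.In e fam_exprs -> N <= W ->
  rexec (cexp m e 2) (base n N, 0, o) (upd (base n N) 2 (eval x (envx x N) e), 0, o).
Proof.
move=> he hN; apply: (@cexp_ok m x B e 2 (base n N) o (envx x N) (n + W).+1) => //.
- by case; rewrite /envx; lia.
- exact: all_In scratch_m he.
- by case=> [|[|]].
- exact: all_In bnd_B he.
Qed.

Lemma upd_base k N : upd (base k N) 2 0 = base k N.
Proof. by apply: functional_extensionality => -[|[|[|]]]. Qed.

Lemma m4 : 4 <= m.
Proof. by have := all_In (e := EVar true) scratch_m; apply; rewrite /=; tauto. Qed.

Lemma rexec_pr e N o : List.In e fam_exprs -> N <= W ->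
  rexec (pr e) (base n N, 0, o) (base n N, 0, o ++ encN (eval x (envx x N) e)).
Proof.
move=> he hN; have hm := m4.
apply: rexec_seq (rexec_eval o he hN) _.
apply: rexec_seq; first by apply: rexec_out; lia.
apply: rexec_clear => //; first lia.
apply: functional_extensionality => k; rewrite /upd /=.
by case: eqP => // ->.
Qed.

Lemma rexec_pr_gate N o : N < W ->
  rexec pr_gate (base n N, 0, o) (base n N, 0, o ++ enc_gate (fam_gate F x N)).
Proof.
move=> hN; have hm := m4; have hN' := ltnW hN.
have assoc4 (T : Type) (s a b c d : seq T) :
  s ++ a ++ b ++ c ++ d = (((s ++ a) ++ b) ++ c) ++ d by rewrite !catA.
have assoc5 (T : Type) (s a b c d e : seq T) :
  s ++ a ++ b ++ c ++ d ++ e = ((((s ++ a) ++ b) ++ c) ++ d) ++ e by rewrite !catA.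
apply: rexec_seq (rexec_pr _ _ hN') _; first by rewrite /=; tauto.
apply: rexec_seq (rexec_eval _ _ hN') _; first by rewrite /=; tauto.
rewrite /fam_gate; case E: (eval x _ (fam_kind F)) => [|k].
  rewrite upd_base.
  apply: rexec_if (@rexec_dec0 _ _ _ 2 (base n N) 0 _ _ _) _ => //; first lia.
  apply: rexec_seq (rexec_pr _ _ hN') _; first by rewrite /=; tauto.
  apply: rexec_seq (rexec_pr _ _ hN') _; first by rewrite /=; tauto.
  have -> : forall G, enc_gate (N, LIn G, [::]) = encN N ++ encN 0 ++ encN G ++ encN 0.
    by move=> G; rewrite /enc_gate [flatten _]/= cats0 -!catA.
  by rewrite assoc4; apply: rexec_pr => //=; tauto.
have hd := @rexec_dec m x B 2 (upd (base n N) 2 k.+1) 0 (o ++ encN N) k.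
apply: rexec_if (hd _ _) _ => {hd} //; first lia.
apply: (rexec_seq (s1 := (base n N, 0, o ++ encN N))).
  apply: rexec_clear => //; first lia.
  by apply: functional_extensionality => -[|[|[|]]].
apply: rexec_seq (rexec_pr _ _ hN') _; first by rewrite /=; tauto.
apply: rexec_seq (rexec_pr _ _ hN') _; first by rewrite /=; tauto.
apply: rexec_seq (rexec_pr _ _ hN') _; first by rewrite /=; tauto.
set p1 := eval _ _ (fam_p1 F); set p2 := eval _ _ (fam_p2 F).
have -> : enc_gate (match k with 0 => (N, LBin OTimes, [:: p1; p2]) | _ => (N, LBin ODiv, [:: p1; p2]) end)
  = encN N ++ encN (eval x (envx x N) e_label) ++ encN 2 ++ encN p1 ++ encN p2.
  have -> : eval x (envx x N) e_label = 6 + (k.+1 - 1 - (k.+1 - 2)) by rewrite /= E.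
  case: (k) => [|k']; rewrite /enc_gate [flatten _]/= cats0 //.
  by have -> : 6 + (k'.+2 - 1 - (k'.+2 - 2)) = 7 by lia.
by rewrite assoc5; apply: rexec_pr => //=; tauto.
Qed.

Lemma rexec_prologue : rexec prologue (base 0 0, 0, [::]) (base n 0, 0, [::]).
Proof.
have hm := m4; have hB : (n + W).+1 < 2 ^ B.
  by have := all_In (e := EVar true) bnd_B; apply; rewrite /=; tauto.
apply: (rexec_seq (s1 := (base n 0, n, [::]))).
  exists false.
  suff H d k : k + d = n -> rexecb (m:=m) x B (whilem (intest m isSome) (seqm (incm 0) (ihR m)))
     (base k 0, k, [::]) false (base n 0, n, [::]) by apply: (H n).
  elim: d k => [|d IH] k e.
    have -> : k = n by lia.
    apply: rexec_while0; have := @rexec_intest m x B isSome (base n 0) n [::].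
    by rewrite /rd ltnn.
  apply: (rexec_while1 (s1 := (base k 0, k, [::])) (s2 := (base k.+1 0, k.+1, [::]))).
  - have := @rexec_intest m x B isSome (base k 0) k [::].
    rewrite /rd; have -> : k < n by lia. by [].
  - apply: (rexec_seq (s1 := (base k.+1 0, k, [::]))).
      apply: rexec_inc'; [lia|rewrite /=; lia|].
      by apply: functional_extensionality => -[|[|[|]]] //=; rewrite /upd /= addn1.
    by apply: rexec_put => /=; lia.
  - by apply: IH; lia.
apply: (rexec_seq (s1 := (base 0 n, 0, [::]))).
  apply: (rexec_loop (S := fun a => (base a (n - a), a, [::])) (A := n)) => //; first lia.
  - by rewrite subnn.
  - by rewrite subn0.
  - move=> a ha; apply: (rexec_seq (s1 := (base a (n - a), a.+1, [::]))).
      apply: rexec_inc'; [lia|rewrite /upd /=; lia|].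
      by apply: functional_extensionality => -[|[|[|]]] //=; rewrite /upd /=; lia.
    by apply: rexec_put => /=; lia.
apply: (rexec_loop (S := fun a => (base (n - a) a, 0, [::])) (A := n)) => //; first lia.
- by rewrite subnn.
- by rewrite subn0.
- move=> a ha; apply: rexec_inc'; [lia|rewrite /upd /=; lia|].
  by apply: functional_extensionality => -[|[|[|]]] //=; rewrite /upd /=; lia.
Qed.

Lemma rexec_program_tail :
  rexec (seqm prologue (seqm (pr (fam_out F)) (seqm (pr (fam_size F))
  (seqm (cexp m (fam_size F) 2) (seqm (loopm 2 (incm 1))
  (seqm (loopm 1 pr_gate) (pr (EConst 0)))))))) (base 0 0, 0, [::])
  (base n 0, 0, enc_instance (fam_circuit F x) 0).
Proof.
have hm := m4; have hB : (n + W).+1 < 2 ^ B.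
  by have := all_In (e := EVar true) bnd_B; apply; rewrite /=; tauto.
apply: rexec_seq rexec_prologue _.
apply: rexec_seq (rexec_pr _ _ _) _; [by rewrite /=; tauto|by []|].
apply: rexec_seq (rexec_pr _ _ _) _; [by rewrite /=; tauto|by []|].
apply: rexec_seq (rexec_eval _ _ _) _; [by rewrite /=; tauto|by []|].
rewrite -/(fam_width F x) cat0s; set o := _ ++ _.
apply: (rexec_seq (s1 := (base n W, 0, o))).
  apply: (rexec_loop (S := fun a => (upd (base n (W - a)) 2 a, 0, o)) (A := W)) => //; first lia.
  - by rewrite subnn.
  - by rewrite subn0 upd_base.
  - move=> a ha; apply: rexec_inc'; [lia|rewrite /upd /=; lia|].
    by apply: functional_extensionality => -[|[|[|]]] //=; rewrite /upd /=; lia.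
have split_gates G a : a <= W -> exists l, gates G W = l ++ gates G a /\ size l = W - a.
  elim: W a => [|w IH] a; first by rewrite leqn0 => /eqP ->; exists [::].
  rewrite leq_eqVlt => /orP[/eqP ->|]; first by exists [::]; rewrite subnn.
  by rewrite ltnS => h; have [l [e1 e2]] := IH a h; exists (G w :: l); rewrite /= e1 e2 subSn.
(* The output when the gates with names below a are still to be printed. *)
pose O a := o ++ flatten (map enc_gate (take (W - a) (gates (fam_gate F x) W))).
apply: (rexec_seq (s1 := (base n 0, 0, O 0))).
  apply: (rexec_loop (S := fun a => (base n a, 0, O a)) (A := W)) => //; first lia.
  - by rewrite /O subnn take0 cats0.
  - move=> a ha /=.
    have -> : upd (base n a.+1) 1 a = base n a by apply: functional_extensionality => -[|[|[|]]].
    have -> : O a = O a.+1 ++ enc_gate (fam_gate F x a).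
      have [l [e1 e2]] := split_gates (fam_gate F x) a.+1 ha.
      have t1 : take (W - a.+1) (gates (fam_gate F x) W) = l by rewrite e1 -e2 take_size_cat.
      have t2 : take (W - a) (gates (fam_gate F x) W) = l ++ [:: fam_gate F x a].
        rewrite e1 take_cat e2.
        have -> : (W - a < W - a.+1) = false by lia.
        have -> : W - a - (W - a.+1) = 1 by lia.
        by rewrite /= take0.
      by rewrite /O t1 t2 map_cat flatten_cat /= cats0 catA.
    exact: rexec_pr_gate.
have -> : enc_instance (fam_circuit F x) 0 = O 0 ++ encN 0.
  by rewrite /O subn0 take_oversize ?size_gates // /enc_instance /enc_circuit /fam_circuit /= size_gates -!catA.
by apply: rexec_pr => //=; tauto.
Qed.

Lemma exec_program : exists b s,
  exec x B program (0, fun=> blk m, 0, [::]) b s /\ s.2 = enc_instance (fam_circuit F x) 0.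
Proof.
have [b H] := rexec_program_tail.
have e0 : base 0 0 = fun=> 0 by apply: functional_extensionality => -[|[|]].
have R := rep_blk m B; rewrite -e0 in R.
have [/= tp [vis [_ _ E]]] := H (leq0n _) _ _ R.
exists b, (0, tp, 0, enc_instance (fam_circuit F x) 0); split=> //.
by apply: (exec_seq (b := true) _ E); apply: exec_put; rewrite /= ?min0n // => k; case: eqP => [->|].
Qed.
End Program.

(** * From polynomial values to logarithmic space *)

Lemma bound_all (es : seq expr) k : exists K, forall n b, b <= (n + 2) ^ k ->
  all (fun e => bnd e b <= (n + 2) ^ K) es.
Proof.
elim: es => [|e es [K IH]]; first by exists 0.
have [K' h] := bnd_poly e k; exists (K + K') => n b hb /=.
have X n' K1 K2 : (n' + 2) ^ K1 <= (n' + 2) ^ (K1 + K2) by rewrite leq_exp2l; lia.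
apply/andP; split; first by rewrite (addnC K K'); apply: leq_trans (h n b hb) (X _ _ _).
by apply: sub_all (IH n b hb) => e' /leq_trans; apply.
Qed.

(** X = [2 ^ (trunc_log 2 n).+1] satisfies [n + 2 <= X ^ 2], whence the factor 2; one more X gives
    strictness. *)
Lemma exp_logbound n K : (n + 2) ^ K < 2 ^ logbound (2 * K + 1) n.
Proof.
rewrite /logbound mulnC expnM.
have h : n < 2 ^ (trunc_log 2 n).+1 by apply: trunc_log_ltn.
have h2 : 2 <= 2 ^ (trunc_log 2 n).+1 by rewrite expnS leq_pmulr ?expn_gt0.
move: (2 ^ _) h h2 => X h h2.
rewrite addn1 expnS expnM.
have h3 : (n + 2) ^ K <= (X ^ 2) ^ K by case: (K) => [|k]; rewrite ?expn0 ?leq_exp2r //; nia.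
have : 0 < (n + 2) ^ K by rewrite expn_gt0 addn2.
nia.
Qed.

Theorem fam_logspace (F : gate_family) :
  logspace_computable (fun x => enc_instance (fam_circuit F x) 0).
Proof.
pose m := sumn (map (fun e => 2 + scratch e) (fam_exprs F)).
(* The number W of gates is itself the value of an expression in n. Its bound limits the gate name
   in all other expressions, and [K0 + 3] has room for n + W + 1. *)
have [K0 hK0] := bnd_poly (fam_size F) 1.
have [K hK] := bound_all (fam_exprs F) (K0 + 3).
exists (ltm_of (blk m) (program F m)), (2 * K + 1) => x.
have hm : all (fun e => 2 + scratch e <= m) (fam_exprs F).
  exact: all_sumn.
have hW : fam_width F x <= (size x + 2) ^ K0.
  apply: leq_trans (hK0 (size x) (size x) _); last by rewrite expn1 leq_addr.
  by apply: eval_bnd; case.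
have hB : all (fun e => bnd e (size x + fam_width F x).+1 < 2 ^ logbound (2 * K + 1) (size x)) (fam_exprs F).
  apply: sub_all (hK (size x) (size x + fam_width F x).+1 _) => [e|].
    by move=> h; apply: leq_ltn_trans h (exp_logbound _ _).
  have : (size x + 2) ^ 2 * (size x + 2) ^ K0 <= (size x + 2) ^ (K0 + 3).
    by rewrite -expnD leq_exp2l; lia.
  have : 0 < (size x + 2) ^ K0 by rewrite expn_gt0 addn2.
  nia.
have [b [s [E es]]] := exec_program hm hB.
by rewrite -es; apply: ltm_of_run E.
Qed.

(** * Injectivity of the encoding *)

Definition bval (l : seq bool) : nat := foldl (fun a (d : bool) => a.*2 + d) 0 l.

Lemma bval_bin n : bval (bin n) = n.
Proof.
rewrite /bin; case: eqP => [->//|_].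
suff H f : forall k, k <= f -> bval (bin_aux f k) = k by apply: H.
elim: f => [|f IH] [|k] hk //.
rewrite [bin_aux _ _]/= /bval foldl_rcons -/(bval _) IH; last by rewrite /=; lia.
by have := odd_double_half k.+1; rewrite [k.+1./2]/= => <-; rewrite addnC.
Qed.

(** Each digit is announced by true and the terminator begins with false, so the code is
    prefix-free. *)
Lemma encN_inj a b s t : encN a ++ s = encN b ++ t -> a = b /\ s = t.
Proof.
move=> H; suff [e ->] : bin a = bin b /\ s = t by rewrite -(bval_bin a) e bval_bin.
move: H; rewrite /encN; move: (bin a) (bin b) => l l'.
elim: l l' => [|d l IH] [|d' l'] //=; first by move=> [->].
by move=> [-> /IH [-> ->]].
Qed.

(* In the next proofs [encN] is generalized to an arbitrary prefix code, since
   rewriting with [catA] would otherwise unfold it. *)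
Lemma enc_label_inj l l' s t : enc_label l ++ s = enc_label l' ++ t -> l = l' /\ s = t.
Proof.
case: l => [v||o]; case: l' => [v'||o']; rewrite /enc_label;
  move: encN encN_inj => E inj; rewrite -?catA => /inj [] //.
- by move=> _ /inj [-> ->].
- by case: o o' => [] [] // _ ->.
Qed.

Lemma enc_seq_inj ps ps' s t : size ps = size ps' ->
  flatten (map encN ps) ++ s = flatten (map encN ps') ++ t -> ps = ps' /\ s = t.
Proof.
move: encN encN_inj => E inj; elim: ps ps' => [|p ps IH] [|p' ps'] //= [] e.
by rewrite -!catA => /inj [-> /(IH _ e) [-> ->]].
Qed.

Lemma enc_gate_inj g g' s t : enc_gate g ++ s = enc_gate g' ++ t -> g = g' /\ s = t.
Proof.
case: g g' => [[n l] ps] [[n' l'] ps']; rewrite /enc_gate /gname /glabel /gpreds.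
move: encN encN_inj enc_label enc_label_inj enc_seq_inj => E inj El injl injs.
rewrite -!catA => /inj [/= -> /injl [-> /inj [e /(injs _ _ _ _ e) [-> ->]]]].
by [].
Qed.

Lemma enc_instance_inj C C' b b' : enc_instance C b = enc_instance C' b' -> C = C' /\ b = b'.
Proof.
case: C C' => [o gs] [o' gs']; rewrite /enc_instance /enc_circuit.
move: encN encN_inj enc_gate enc_gate_inj => E inj Eg injg /=.
rewrite -!catA => /inj [-> /inj [e]].
elim: gs gs' e => [|g gs IH] [|g' gs'] //=.
  by move=> _; rewrite -(cats0 (E b)) -(cats0 (E b')) => /inj [-> _].
by move=> [] e; rewrite -!catA => /injg [-> /(IH _ e) [[->] ->]].
Qed.

(** [MC] asks for some circuit with the given code; injectivity makes it the intended one. *)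
Lemma MC_enc O C b : circuit_ok O C -> MC O (enc_instance C b) <-> circ_val C b.
Proof.
move=> ok; split; last by exists C, b.
by move=> [C' [b' [_ [/enc_instance_inj [<- <-]]]]].
Qed.

(** * Circuits counting accepting paths *)

Section Gates.
Variable G : nat -> gate.
Hypothesis nameG : forall N, gname (G N) = N.

Lemma mem_gates W p : (p \in map gname (gates G W)) = (p < W).
Proof. by elim: W => //= W IH; rewrite inE IH nameG ltnS [RHS]leq_eqVlt. Qed.

Lemma uniq_gates W : uniq (map gname (gates G W)).
Proof. by elim: W => //= W IH; rewrite IH mem_gates nameG ltnn. Qed.

Lemma nth_gates g W i : i < W -> nth g (gates G W) i = G (W - i.+1).
Proof. by elim: W i => // W IH [|i] h //=; rewrite ?subSS ?subn0 // IH. Qed.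

Lemma drop_gates W i : drop i (gates G W) = gates G (W - i).
Proof. by elim: W i => [|W IH] [|i] //=. Qed.

Lemma geval_gates W n : n < W -> geval (gates G W) n = gval (geval (gates G n)) (G n).
Proof.
elim: W => // W IH; rewrite ltnS leq_eqVlt => /orP[/eqP -> | h] /=.
  by rewrite nameG eqxx.
by rewrite nameG gtn_eqF // IH.
Qed.

(** A gate depends only on gates with smaller names, so the length of the surrounding list can be
    normalized. *)
Definition wire (n : nat) : nat -> Prop := geval (gates G n.+1) n.

Lemma geval_wire W n : n < W -> geval (gates G W) n = wire n.
Proof. by move=> h; rewrite /wire !geval_gates. Qed.

Lemma wire_in n v : glabel (G n) = LIn v -> wire n = fun c => c = v.
Proof. by move=> e; rewrite /wire geval_gates // /gval e. Qed.

Lemma wire_bin n o p q : glabel (G n) = LBin o -> gpreds (G n) = [:: p; q] ->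
  p < n -> q < n -> wire n = opsem o (wire (minn p q)) (wire (maxn p q)).
Proof.
move=> e1 e2 hp hq; rewrite [wire n]/wire geval_gates // /gval e1 e2 /=.
by rewrite -!(@geval_wire n) // ?gtn_max ?gtn_min ?hp ?hq.
Qed.

End Gates.

(** * The layered circuit and its threshold test *)

Section Count.
Variables (S T i0 : nat) (d0 d1 : nat -> nat) (ac : nat -> bool).
Hypothesis S0 : 0 < S.
Hypothesis d0S : forall a, d0 a < S.
Hypothesis d1S : forall a, d1 a < S.
Hypothesis i0S : i0 < S.

Definition top : nat := T.+1 * S.

Fixpoint cnt (t a : nat) : nat :=
  if t is t'.+1 then cnt t' (d0 a) + cnt t' (d1 a) else ac a.

(** Gate [t * S + a] belongs to the pair (t, a). Gate [T * S] is code 0 with T steps left, and gate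
    0, of value 2, is the extra factor. Operands are taken in the order of their names, so the
    dividend [top] has to come before the divisor [top + 1]. *)
Definition cgate (N : nat) : gate :=
  let t := N %/ S in let a := N %% S in
  if N < top then
    if t == 0 then (N, LIn (1 + ac a), [::])
    else (N, LBin OTimes, [:: t.-1 * S + d0 a; t.-1 * S + d1 a])
  else match N - top with
  | 0 => (N, LBin OTimes, [:: T * S + i0; T * S + i0])
  | 1 => (N, LBin OTimes, [:: T * S; 0])
  | 2 => (N, LBin ODiv, [:: top; top + 1])
  | 3 => (N, LIn 0, [::])
  | _ => (N, LBin OTimes, [:: top + 2; top + 3])
  end.

Lemma cgate_name N : gname (cgate N) = N.
Proof. by rewrite /cgate; case: ifP => _; [case: ifP|case: (N - top) => [|[|[|[|]]]]]. Qed.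

Lemma pred_lt N a : N %/ S != 0 -> a < S -> (N %/ S).-1 * S + a < N.
Proof.
move=> h aS; rewrite [X in _ < X](divn_eq N S); move: (N %/ S) h (N %% S) => [|t] //= _ r.
by rewrite mulSn; lia.
Qed.

Lemma lt_top t a : t <= T -> a < S -> t * S + a < top.
Proof.
move=> ht ha; rewrite /top mulSn; have := leq_mul ht (leqnn S); lia.
Qed.

Lemma cgate_ok : circuit_ok O_times_div (top + 4, gates cgate (top + 5)).
Proof.
split=> [|/=]; first exact: uniq_gates cgate_name _.
rewrite mem_gates ?size_gates; last exact: cgate_name.
split=> [|i hi]; first by lia.
(* Position i holds gate N and is followed by exactly the gates below N, so the order condition
   becomes p < N. *)
rewrite /gate_ok nth_gates // drop_gates; set N := _ - i.+1.
have : N < top + 5 by rewrite /N; lia.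
move: N => {hi i} N hN; split.
  move=> p; rewrite mem_gates; last exact: cgate_name.
  rewrite /cgate; case: ltnP => hT.
    case: eqP => // /eqP h; rewrite !inE => /orP[] /eqP ->; exact: pred_lt.
  have h0 := lt_top (leqnn T) S0; have hi := lt_top (leqnn T) i0S.
  have -> : N = top + (N - top) by lia.
  have : N - top < 5 by lia.
  move: (N - top) => u; rewrite addKn; rewrite addn0 in h0.
  by case: u => [|[|[|[|[|u]]]]] //= _; rewrite !inE => /orP[] /eqP ->; lia.
rewrite /cgate; case: ltnP => hT; first by case: eqP.
by case: (N - top) => [|[|[|[|]]]].
Qed.

Definition sing (n v : nat) : Prop := forall c, wire cgate n c <-> c = v.

Lemma sing_in n v : glabel (cgate n) = LIn v -> sing n v.
Proof. by move=> e c; rewrite (wire_in cgate_name e). Qed.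

Lemma sing_mul n p q u v : glabel (cgate n) = LBin OTimes -> gpreds (cgate n) = [:: p; q] ->
  p < n -> q < n -> sing p u -> sing q v -> sing n (u * v).
Proof.
move=> e1 e2 hp hq su sv c; rewrite (wire_bin cgate_name e1 e2 hp hq) /=.
have [h|h] := leqP p q; split.
- by move=> [a [b [/su -> [/sv -> ->]]]].
- by move=> ->; exists u, v; split; [exact/su|split=> //; exact/sv].
- by move=> [a [b [/sv -> [/su -> ->]]]]; rewrite mulnC.
- by move=> ->; exists v, u; rewrite mulnC; split; [exact/sv|split=> //; exact/su].
Qed.

Lemma sing_cnt t a : t <= T -> a < S -> sing (t * S + a) (2 ^ cnt t a).
Proof.
elim: t a => [|t IH] a ht ha.
  apply: sing_in.
  rewrite /cgate lt_top // mul0n add0n divn_small // modn_small //=.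
  by case: (ac a).
have E : cgate (t.+1 * S + a) =
    (t.+1 * S + a, LBin OTimes, [:: t * S + d0 a; t * S + d1 a]).
  by rewrite /cgate lt_top // divnMDl // modnMDl divn_small // modn_small // addn0.
have lt b : b < S -> t * S + b < t.+1 * S + a by rewrite mulSn; lia.
by rewrite /= expnD; apply: sing_mul; rewrite ?E ?lt //; apply: IH => //; apply: ltnW.
Qed.

Hypothesis d00 : d0 0 = 0.
Hypothesis d10 : d1 0 = 0.
Hypothesis ac0 : ac 0.

(** Code 0 is an accepting fixed point of both successor maps, so all continuations accept. *)
Lemma cnt_full t : cnt t 0 = 2 ^ t.
Proof. by elim: t => /= [|t IH]; rewrite ?ac0 // d00 d10 IH addnn -mul2n expnS. Qed.

Lemma circ_val_cgate :
  circ_val (top + 4, gates cgate (top + 5)) 0 <-> 2 ^ T < 2 * cnt T i0.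
Proof.
rewrite /circ_val /= geval_wire ?cgate_name //; [|exact: cgate_name|by lia].
have h0 : T * S < top by rewrite -[T * S]addn0 lt_top.
have hi := lt_top (leqnn T) i0S.
have E u : cgate (top + u) = match u with
  | 0 => (top + u, LBin OTimes, [:: T * S + i0; T * S + i0])
  | 1 => (top + u, LBin OTimes, [:: T * S; 0])
  | 2 => (top + u, LBin ODiv, [:: top; top + 1])
  | 3 => (top + u, LIn 0, [::])
  | _ => (top + u, LBin OTimes, [:: top + 2; top + 3]) end.
  by rewrite /cgate ltnNge leq_addr /= addKn.
have s0 : sing (top + 0) (2 ^ cnt T i0 * 2 ^ cnt T i0).
  by apply: (sing_mul (p := T * S + i0) (q := T * S + i0)); rewrite ?E ?addn0 //; exact: sing_cnt.
have s1 : sing (top + 1) (2 ^ 2 ^ T * 2).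
  apply: (sing_mul (p := T * S) (q := 0)); rewrite ?E //; try lia.
    by rewrite -[T * S]addn0 -(cnt_full T); exact: sing_cnt.
  by have := sing_cnt (leq0n T) S0; rewrite /= ac0 addn0.
have s3 : sing (top + 3) 0 by apply: sing_in; rewrite E.
rewrite -expnD addnn -mul2n in s0; rewrite mulnC -expnS in s1.
have w2 : wire cgate (top + 2) = opsem ODiv (wire cgate (top + 0)) (wire cgate (top + 1)).
  rewrite (wire_bin cgate_name (o := ODiv) (p := top + 0) (q := top + 1)); rewrite ?E ?addn0 //; try lia.
  by rewrite (minn_idPl _) ?(maxn_idPr _) //; lia.
rewrite (wire_bin cgate_name (o := OTimes) (p := top + 2) (q := top + 3)); rewrite ?E //; try lia.
rewrite (minn_idPl _) ?(maxn_idPr _) //=; try lia.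
rewrite w2 /=; split.
  move=> [a [_ [[a' [b' [/s0 -> [/s1 -> [_ e]]]]] _]]].
  (* An element of the quotient witnesses divisibility, which for powers of 2 compares the
     exponents; the successor makes the comparison strict. *)
  have : 2 ^ (2 ^ T).+1 %| 2 ^ (2 * cnt T i0) by rewrite e dvdn_mull.
  by rewrite dvdn_Pexp2l.
move=> h; exists (2 ^ (2 * cnt T i0 - (2 ^ T).+1)), 0; split; last first.
  by rewrite muln0; split=> //; apply/s3.
exists (2 ^ (2 * cnt T i0)), (2 ^ (2 ^ T).+1).
split; first exact/s0.
split; first exact/s1.
split; last by rewrite -expnD subnK.
by apply/eqP; rewrite expn_eq0.
Qed.

End Count.

(** * Numerical simulation of a probabilistic machine *)

(** Undoes the shift of [EDiv] for positive b. The tests below take the values 0 and 1 by truncated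
    subtraction. *)
Definition eDivp (a b : expr) := EDiv a (ESub b (EConst 1)).
Definition eMod (a b : expr) := ESub a (EMul (eDivp a b) b).
Definition eEq (a b : expr) := ESub (EConst 1) (EAdd (ESub a b) (ESub b a)).
Definition eLt (a b : expr) := ESub (EConst 1) (ESub (EAdd a (EConst 1)) b).
Definition eIf (e a b : expr) := EAdd (EMul e a) (EMul (ESub (EConst 1) e) b).
Fixpoint ePow (e : expr) (k : nat) := if k is k'.+1 then EMul e (ePow e k') else EConst 1.
Fixpoint eTab (f : nat -> nat) (K : nat) (e : expr) :=
  if K is K'.+1 then EAdd (eTab f K' e) (EMul (EConst (f K')) (eEq e (EConst K')))
  else EConst 0.

(** Evaluates the transition at the configuration part of a gate name instead of the whole name. *)
Fixpoint esubst (s e : expr) : expr :=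
  match e with
  | EConst c => EConst c
  | EVar b => if b then s else EVar b
  | EAdd a b => EAdd (esubst s a) (esubst s b)
  | ESub a b => ESub (esubst s a) (esubst s b)
  | EMul a b => EMul (esubst s a) (esubst s b)
  | EDiv a b => EDiv (esubst s a) (esubst s b)
  | EInp a => EInp (esubst s a)
  end.

Lemma eval_esubst x N s e :
  eval x (envx x N) (esubst s e) = eval x (envx x (eval x (envx x N) s)) e.
Proof. by elim: e => //= [[]|a -> b ->|a -> b ->|a -> b ->|a -> b ->|a ->]. Qed.

Section EvalLemmas.
Variables (x : seq bool) (env : bool -> nat).
Notation ev := (eval x env).

Lemma ev_const n : ev (EConst n) = n. Proof. by []. Qed.
Lemma ev_var b : ev (EVar b) = env b. Proof. by []. Qed.
Lemma ev_add a b : ev (EAdd a b) = ev a + ev b. Proof. by []. Qed.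
Lemma ev_sub a b : ev (ESub a b) = ev a - ev b. Proof. by []. Qed.
Lemma ev_mul a b : ev (EMul a b) = ev a * ev b. Proof. by []. Qed.
Lemma ev_inp a : ev (EInp a) = rdcode (rd x (minn (ev a) (size x))). Proof. by []. Qed.

Lemma ev_div a b : 0 < ev b -> ev (eDivp a b) = ev a %/ ev b.
Proof. by move=> h; rewrite /= subn1 prednK. Qed.

Lemma ev_mod a b : 0 < ev b -> ev (eMod a b) = ev a %% ev b.
Proof. by move=> h; rewrite /eMod ev_sub ev_mul ev_div // {1}(divn_eq (ev a) (ev b)) addKn. Qed.

Lemma ev_eq a b : ev (eEq a b) = (ev a == ev b).
Proof. by rewrite /=; case: eqP; lia. Qed.

Lemma ev_lt a b : ev (eLt a b) = (ev a < ev b).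
Proof. by rewrite /=; case: ltnP; lia. Qed.

Lemma ev_if e a b (t : bool) : ev e = t -> ev (eIf e a b) = if t then ev a else ev b.
Proof. by rewrite /= => ->; case: t; rewrite /= ?mul0n ?mul1n ?addn0 // subnn mul0n addn0. Qed.

Lemma ev_pow e k : ev (ePow e k) = ev e ^ k.
Proof. by elim: k => //= k ->; rewrite expnS. Qed.

Lemma ev_tab f K e : ev (eTab f K e) = if ev e < K then f (ev e) else 0.
Proof.
elim: K => //= K ->; have /= -> := ev_eq e (EConst K).
by case: (ltngtP (ev e) K) => [h|h|->]; rewrite ?muln0 ?muln1 ?addn0 ?ltnS ?leqnn ?(ltnW h) // leqNgt h.
Qed.
End EvalLemmas.

Section Simulation.
Variables (M : PTM) (k c : nat).
Notation Q := (ptm_Q M).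
Notation A := (ptm_G M).

(* State number 0 is an additional accepting state that never moves; its
   configurations provide the gates with value 2 ^ (2 ^ t). *)
Definition nq : nat := #|Q|.+1.
Definition qnum (q : Q) : nat := (enum_rank q).+1.
Definition qof (a : nat) : option Q := if a is a'.+1 then onth (enum Q) a' else None.

(** The blank is digit 0, so the infinite blank part of the tape vanishes in a number in base [ng].
    The spare digit makes the base at least 2 for every alphabet. *)
Definition ng : nat := #|A|.+1.
Definition gnum (s : A) : nat := if s == ptm_blank M then 0 else (enum_rank s).+1.
Definition gof (a : nat) : A := if a is a'.+1 then nth (ptm_blank M) (enum A) a' else ptm_blank M.

Definition rof (a : nat) : option bool :=
  match a with 0 => None | 1 => Some false | _ => Some true end.

(** Shifted by 1, so that i + [mnum m] - 1 with truncated subtraction is the moved head, even for a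
    left move at cell 0. *)
Definition mnum (m : move) : nat := match m with MLeft => 0 | MStay => 1 | MRight => 2 end.

Lemma qnumK q : qof (qnum q) = Some q.
Proof.
have h : enum_rank q < size (enum Q) by rewrite -cardE.
by rewrite /qof /qnum onthE (nth_map q) // nth_enum_rank.
Qed.

Lemma qnum_lt q : qnum q < nq. Proof. by rewrite /qnum /nq ltnS. Qed.

Lemma gnumK s : gof (gnum s) = s.
Proof. by rewrite /gnum; case: eqP => [->//|_]; rewrite /= nth_enum_rank. Qed.

Lemma gnum_lt s : gnum s < ng.
Proof. by rewrite /gnum /ng; case: eqP => // _; rewrite ltnS. Qed.

Lemma ng_gt1 : 1 < ng.
Proof. by rewrite /ng ltnS; apply/card_gt0P; exists (ptm_blank M). Qed.

Lemma rdcodeK r : rof (rdcode r) = r. Proof. by case: r => [[]|]. Qed.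
Lemma rdcode_lt r : rdcode r < 3. Proof. by case: r => [[]|]. Qed.

Definition idx (q r s : nat) : nat := (q * 3 + r) * ng + s.

Lemma idx_lt q r s : q < nq -> r < 3 -> s < ng -> idx q r s < nq * 3 * ng.
Proof.
rewrite /idx => hq hr hs.
have h : q * 3 + r < nq * 3 by lia.
by apply: leq_trans (leq_mul h (leqnn ng)); rewrite mulSn; lia.
Qed.

Lemma idx_s q r s : s < ng -> idx q r s %% ng = s.
Proof. by move=> h; rewrite /idx modnMDl modn_small. Qed.
Lemma idx_div q r s : s < ng -> idx q r s %/ ng = q * 3 + r.
Proof. by move=> h; rewrite /idx divnMDl // [s %/ ng]divn_small // addn0. Qed.
Lemma idx_r q r s : r < 3 -> s < ng -> idx q r s %/ ng %% 3 = r.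
Proof. by move=> h1 h; rewrite idx_div // modnMDl modn_small. Qed.
Lemma idx_q q r s : r < 3 -> s < ng -> idx q r s %/ ng %/ 3 = q.
Proof. by move=> h1 h; rewrite idx_div // divnMDl // [r %/ 3]divn_small // addn0. Qed.

Definition tdelta (b : bool) (a : nat) : option (Q * A * move * move) :=
  omap (fun q => ptm_delta M q (rof (a %/ ng %% 3)) (gof (a %% ng)) b) (qof (a %/ ng %/ 3)).
Definition tab_q b a := if tdelta b a is Some (q, _, _, _) then qnum q else 0.
Definition tab_g b a := if tdelta b a is Some (_, s, _, _) then gnum s else 0.
Definition tab_i b a := if tdelta b a is Some (_, _, mi, _) then mnum mi else 0.
Definition tab_w b a := if tdelta b a is Some (_, _, _, mw) then mnum mw else 0.
Definition halted (a : nat) : bool := if qof a is Some q then ptm_halt M q else true.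
Definition accepting (a : nat) : bool := if qof a is Some q then ptm_acc M q else true.

Lemma tdelta_idx b q r s :
  tdelta b (idx (qnum q) (rdcode r) (gnum s)) = Some (ptm_delta M q r s b).
Proof.
by rewrite /tdelta idx_s ?gnum_lt // idx_r ?gnum_lt ?rdcode_lt // idx_q ?gnum_lt ?rdcode_lt //
  qnumK rdcodeK gnumK.
Qed.

Definition eN1 : expr := EAdd (EVar false) (EConst 1).
(** A polynomial substitute for [ng ^ B.+1], which bounds both stacks but has a logarithm in its
    exponent. *)
Definition eR : expr := ePow (EAdd (EVar false) (EConst 2)) (2 * (ng * c.+1)).
Definition eS : expr := EMul (EConst nq) (EMul eN1 (EMul eR eR)).
Definition eCode (q i l r : expr) : expr :=
  EAdd q (EMul (EConst nq) (EAdd i (EMul eN1 (EAdd l (EMul eR r))))).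

Section Delta.
Variables (b : bool) (e : expr).
Definition e_q := eMod e (EConst nq).
Definition e_1 := eDivp e (EConst nq).
Definition e_i := eMod e_1 eN1.
Definition e_2 := eDivp e_1 eN1.
Definition e_l := eMod e_2 eR.
Definition e_r := eDivp e_2 eR.
Definition e_idx := EAdd (EMul (EAdd (EMul e_q (EConst 3)) (EInp e_i)) (EConst ng)) (eMod e_r (EConst ng)).
Definition e_tab (f : nat -> nat) := eTab f (nq * 3 * ng) e_idx.
Definition e_g := e_tab (tab_g b).
Definition e_mi := e_tab (tab_i b).
Definition e_mw := e_tab (tab_w b).
Definition e_i0 := ESub (EAdd e_i e_mi) (EConst 1).
(** The minimum with the input length, as a double truncated difference. *)
Definition e_i' := ESub e_i0 (ESub e_i0 (EVar false)).
Definition e_rg := eDivp e_r (EConst ng).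
Definition e_r0 := EAdd (EMul e_rg (EConst ng)) e_g.
Definition e_l' :=
  eIf (eEq e_mw (EConst 2)) (EAdd (EMul e_l (EConst ng)) e_g)
  (eIf (eEq e_mw (EConst 1)) e_l
  (eIf (eEq e_l (EConst 1)) e_l (eDivp e_l (EConst ng)))).
Definition e_r' :=
  eIf (eEq e_mw (EConst 2)) e_rg
  (eIf (eEq e_mw (EConst 1)) e_r0
  (eIf (eEq e_l (EConst 1)) e_r0 (EAdd (EMul e_r0 (EConst ng)) (eMod e_l (EConst ng))))).
(** The reduction modulo [eS] keeps successors of arbitrary codes among the gate offsets; it has no
    effect when the next configuration respects the space bound. *)
Definition e_delta :=
  eMod (eIf (eTab halted nq e_q) e (eCode (e_tab (tab_q b)) e_i' e_l' e_r')) eS.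
Definition e_acc := eTab accepting nq e_q.
End Delta.

Variable x : seq bool.
Notation n := (size x).
Definition nR : nat := (n + 2) ^ (2 * (ng * c.+1)).
Definition nS : nat := nq * ((n + 1) * (nR * nR)).
Definition B : nat := logbound c n.
Definition code (q i l r : nat) : nat := q + nq * (i + (n + 1) * (l + nR * r)).

Lemma nR_gt0 : 0 < nR. Proof. by rewrite /nR expn_gt0 addn2. Qed.

Lemma nS_gt0 : 0 < nS. Proof. by rewrite /nS !muln_gt0 nR_gt0 addn1. Qed.

(** With log for [trunc_log 2]: ng <= 2 ^ ng, B + 1 <= (c + 1) * (log n + 1) and 2 ^ (log n + 1) <=
    (n + 2) ^ 2. These three bounds explain the exponent in [eR]. *)
Lemma nR_ge : ng ^ B.+1 <= nR.
Proof.
have h1 : 2 ^ (trunc_log 2 n).+1 <= (n + 2) ^ 2.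
  case: (posnP n) => [->|n0]; first by rewrite trunc_log0.
  have := trunc_logP (isT : 1 < 2) n0; rewrite expnS; nia.
have h2 : ng ^ B.+1 <= (2 ^ ng) ^ B.+1 by rewrite leq_exp2r // ltnW // ltn_expl.
apply: leq_trans h2 _.
have h3 : ng * B.+1 <= (trunc_log 2 n).+1 * (ng * c.+1) by rewrite /B /logbound; nia.
rewrite -expnM; apply: leq_trans (leq_pexp2l _ h3) _ => //.
by rewrite /nR !expnM !leq_exp2r // muln_gt0.
Qed.

Section Eval.
Variable N : nat.
Notation ev := (eval x (envx x N)).

Lemma ev_N1 : ev eN1 = n + 1. Proof. by []. Qed.
Lemma ev_R : ev eR = nR. Proof. by rewrite /eR ev_pow. Qed.
Lemma ev_S : ev eS = nS. Proof. by rewrite /eS 3!ev_mul ev_const ev_R. Qed.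
Lemma ev_code q i l r : ev (eCode q i l r) = code (ev q) (ev i) (ev l) (ev r).
Proof. by rewrite /eCode ev_add ev_mul ev_add ev_mul ev_add ev_mul ev_R. Qed.

End Eval.

Lemma code_lt q i l r : q < nq -> i <= n -> l < nR -> r < nR -> code q i l r < nS.
Proof.
rewrite /code /nS => hq hi hl hr.
have h1 : l + nR * r < nR * nR by have := leq_mul (leqnn nR) hr; rewrite mulnS; lia.
have h2 : i + (n + 1) * (l + nR * r) < (n + 1) * (nR * nR).
  by have := leq_mul (leqnn (n + 1)) h1; rewrite mulnS; lia.
by have := leq_mul (leqnn nq) h2; rewrite mulnS; lia.
Qed.

Definition nextl (mw : move) (l a : nat) : nat :=
  match mw with
  | MRight => l * ng + a
  | MStay => l
  | MLeft => if l == 1 then l else l %/ ng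
  end.

Definition nextr (mw : move) (l r a : nat) : nat :=
  let r0 := r %/ ng * ng + a in
  match mw with
  | MRight => r %/ ng
  | MStay => r0
  | MLeft => if l == 1 then r0 else r0 * ng + l %% ng
  end.

Section EvalDelta.
Variables (N : nat) (b : bool) (e : expr) (q i l r : nat).
Notation ev := (eval x (envx x N)).
Hypothesis he : ev e = code q i l r.
Hypothesis hq : q < nq.
Hypothesis hi : i <= n.
Hypothesis hl : l < nR.
Hypothesis hr : r < nR.

Lemma ev_e_q : ev (e_q e) = q.
Proof. by rewrite /e_q ev_mod ev_const // he /code addnC mulnC modnMDl modn_small. Qed.

Lemma ev_e_1 : ev (e_1 e) = i + (n + 1) * (l + nR * r).
Proof. by rewrite /e_1 ev_div ev_const // he /code addnC mulnC divnMDl // divn_small ?addn0. Qed.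

Lemma ev_e_i : ev (e_i e) = i.
Proof.
rewrite /e_i ev_mod ev_N1 ?addn1 // ev_e_1 addnC mulnC addn1 modnMDl modn_small //.
Qed.

Lemma ev_e_2 : ev (e_2 e) = l + nR * r.
Proof.
by rewrite /e_2 ev_div ev_N1 ?addn1 // ev_e_1 addnC mulnC addn1 divnMDl // divn_small ?addn0.
Qed.

Lemma ev_e_l : ev (e_l e) = l.
Proof. by rewrite /e_l ev_mod ev_R ?nR_gt0 // ev_e_2 addnC mulnC modnMDl modn_small. Qed.

Lemma ev_e_r : ev (e_r e) = r.
Proof.
by rewrite /e_r ev_div ev_R ?nR_gt0 // ev_e_2 addnC mulnC divnMDl ?nR_gt0 // divn_small ?addn0.
Qed.

Lemma ev_e_idx : ev (e_idx e) = idx q (rdcode (rd x i)) (r %% ng).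
Proof.
rewrite /e_idx ev_add ev_mul ev_add ev_mul ev_inp ev_mod ev_const // ev_e_q ev_e_i ev_e_r.
by rewrite (minn_idPl hi).
Qed.

Lemma ev_e_tab f : ev (e_tab e f) = f (idx q (rdcode (rd x i)) (r %% ng)).
Proof. by rewrite /e_tab ev_tab ev_e_idx idx_lt ?rdcode_lt // ltn_pmod. Qed.

Lemma ev_delta_halted : halted q -> ev (e_delta b e) = code q i l r.
Proof.
move=> h; rewrite /e_delta ev_mod ev_S ?nS_gt0 //.
rewrite (@ev_if _ _ _ _ _ (true)); last by rewrite ev_tab ev_e_q hq h.
by rewrite he modn_small // code_lt.
Qed.

Lemma ev_delta_step q0 s q' s' mi mw : q = qnum q0 -> ptm_halt M q0 = false ->
  r %% ng = gnum s -> ptm_delta M q0 (rd x i) s b = (q', s', mi, mw) ->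
  ev (e_delta b e) =
  code (qnum q') (minn (mv mi i) n) (nextl mw l (gnum s')) (nextr mw l r (gnum s')) %% nS.
Proof.
move=> eq0 hh es ed; rewrite /e_delta ev_mod ev_S ?nS_gt0 //; congr (_ %% _).
rewrite (@ev_if _ _ _ _ _ (false)); last by rewrite ev_tab ev_e_q hq eq0 /halted qnumK hh.
have td : tdelta b (idx q (rdcode (rd x i)) (r %% ng)) = Some (q', s', mi, mw).
  by rewrite eq0 es tdelta_idx ed.
have Eg : ev (e_g b e) = gnum s' by rewrite /e_g ev_e_tab /tab_g td.
have Ei : ev (e_mi b e) = mnum mi by rewrite /e_mi ev_e_tab /tab_i td.
have Ew : ev (e_mw b e) = mnum mw by rewrite /e_mw ev_e_tab /tab_w td.
have Er : ev (e_rg e) = r %/ ng by rewrite /e_rg ev_div ev_const // ev_e_r.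
have Er0 : ev (e_r0 b e) = r %/ ng * ng + gnum s' by rewrite /e_r0 ev_add ev_mul Er ev_const Eg.
rewrite ev_code ev_e_tab /tab_q td; congr (code _ _ _ _).
- rewrite /e_i' ev_sub ev_sub /e_i0 ev_sub ev_add ev_e_i Ei ev_const ev_var /envx.
  by case: (mi) => /=; lia.
- rewrite /e_l'.
  rewrite (@ev_if _ _ _ _ _ (mnum mw == 2)); last by rewrite ev_eq Ew.
  rewrite (@ev_if _ _ _ _ _ (mnum mw == 1)); last by rewrite ev_eq Ew.
  rewrite (@ev_if _ _ _ _ _ (l == 1)); last by rewrite ev_eq ev_e_l.
  by rewrite ev_div ?ev_const // ev_add ev_mul ev_e_l Eg ev_const; case: (mw).
- rewrite /e_r'.
  rewrite (@ev_if _ _ _ _ _ (mnum mw == 2)); last by rewrite ev_eq Ew.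
  rewrite (@ev_if _ _ _ _ _ (mnum mw == 1)); last by rewrite ev_eq Ew.
  rewrite (@ev_if _ _ _ _ _ (l == 1)); last by rewrite ev_eq ev_e_l.
  by rewrite ev_add ev_mul ev_mod ?ev_const // ev_e_l Er Er0; case: (mw).
Qed.
End EvalDelta.

(** * Correctness of the coded transition *)

Fixpoint lrep (tp : nat -> A) (j : nat) : nat :=
  if j is j'.+1 then lrep tp j' * ng + gnum (tp j') else 1.

Lemma lrep_eq tp tp' j : (forall u, u < j -> tp u = tp' u) -> lrep tp j = lrep tp' j.
Proof.
elim: j => //= j IH h; rewrite h // IH // => u hu; apply: h; exact: ltnW.
Qed.

Lemma lrep_gt0 tp j : 0 < lrep tp j.
Proof. by elim: j => //= j IH; rewrite addn_gt0 muln_gt0 IH. Qed.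

(** The leading 1 makes head position 0 recognizable even when every cell to the left is blank. *)
Lemma lrep_eq1 tp j : (lrep tp j == 1) = (j == 0).
Proof.
case: j => //= j; apply/eqP => h.
have := lrep_gt0 tp j; have := ng_gt1; nia.
Qed.

Lemma push_lt a u v : u < v -> a < ng -> u * ng + a < v * ng.
Proof. by move=> h ha; apply: leq_trans (leq_mul h (leqnn ng)); rewrite mulSn; lia. Qed.

Lemma lrep_lt tp j : lrep tp j < ng ^ j.+1.
Proof.
elim: j => [|j IH] /=; first by rewrite expn1 ng_gt1.
by rewrite [ng ^ j.+2]expnSr push_lt // gnum_lt.
Qed.

(* The work tape is split at the head into two stacks in base [ng]: [lrep] for the
   cells to the left (with a leading 1 marking the bottom), and [r] for the rest. *)
Definition repc (cf : pcfg M) (a : nat) : Prop :=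
  let: (q, i, tp, j) := cf in exists r,
  [/\ a = code (qnum q) i (lrep tp j) r, i <= n, j <= B,
      forall u, r %/ ng ^ u %% ng = gnum (tp (j + u)) & r < ng ^ (B.+1 - j)].

Definition delta (b : bool) (a : nat) : nat := eval x (envx x a) (e_delta b (EVar true)).

Lemma pow_nR j : j <= B -> ng ^ j.+1 <= nR /\ ng ^ (B.+1 - j) <= nR.
Proof.
by move=> h; have h2 := nR_ge; split; apply: leq_trans h2; rewrite leq_exp2l ?ng_gt1 //; lia.
Qed.

Lemma repc_step cf a b : repc cf a -> (pstep M x cf b).2 <= B ->
  repc (pstep M x cf b) (delta b a).
Proof.
case: cf => [[[q i] tp] j] [r [ea hi hj hd hr]].
have [pl pr] := pow_nR hj.
have hl : lrep tp j < nR by apply: leq_trans pl; apply: lrep_lt.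
have hr' : r < nR by apply: leq_trans pr.
have he : eval x (envx x a) (EVar true) = code (qnum q) i (lrep tp j) r by [].
rewrite /pstep; case: ifP => hh.
  have hq : halted (qnum q) by rewrite /halted qnumK.
  by rewrite /delta (ev_delta_halted b he (qnum_lt q) hi hl hr' hq); exists r.
have es : r %% ng = gnum (tp j) by have := hd 0; rewrite expn0 divn1 addn0.
case ed : (ptm_delta M q (rd x i) (tp j) b) => [[[q' s'] mi] mw] hB.
rewrite /delta (ev_delta_step he (qnum_lt q) hi hl hr' erefl hh es ed).
set tp' := fun u => _; set j' := mv mw j.
have {}hB : j' <= B := hB.
set r' := nextr mw _ r _; set l' := nextl mw _ _.
have lE : lrep tp' j = lrep tp j.
  by apply: lrep_eq => u hu; rewrite /tp'; case: eqP hu => // ->; rewrite ltnn.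
have tj : tp' j = s' by rewrite /tp' eqxx.
have tne u : u != j -> tp' u = tp u by rewrite /tp' => /negbTE ->.
have dS v u : v %/ ng ^ u.+1 %% ng = (v %/ ng) %/ ng ^ u %% ng by rewrite expnS divnMA.
have pop v w : w < ng -> (v * ng + w) %/ ng = v by move=> h; rewrite divnMDl // [w %/ ng]divn_small // addn0.
have gl := gnum_lt s'.
have rd1 : r %/ ng < ng ^ (B - j) by rewrite ltn_divLR // -expnSr -subSn.
set r0 := r %/ ng * ng + gnum s'.
have r0lt : r0 < ng ^ (B.+1 - j) by rewrite subSn // expnSr push_lt.
have r0d u : r0 %/ ng ^ u %% ng = gnum (tp' (j + u)).
  case: u => [|u]; first by rewrite expn0 divn1 modnMDl modn_small // addn0 tj.
  rewrite dS pop // -dS hd tne //; lia.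
have [El Er1 Er2] : [/\ l' = lrep tp' j', forall u, r' %/ ng ^ u %% ng = gnum (tp' (j' + u))
    & r' < ng ^ (B.+1 - j')].
  rewrite /l' /r' /j' /nextl /nextr lrep_eq1 -/r0; case: (mw) hB => /= hB.
  - case: (posnP j) => [j0|]; first by have -> : j.-1 = j by [rewrite j0]; rewrite lE.
    move: hj hd hr lE hl tj tne r0d r0lt; rewrite /j'; case: (j) => // j1 hj hd hr lE hl tj tne r0d r0lt _ /=.
    have gl1 := gnum_lt (tp j1).
    have t1 : tp' j1 = tp j1 by apply: tne; lia.
    have lE1 : lrep tp' j1 = lrep tp j1.
      by apply: lrep_eq => u hu; apply: tne; lia.
    (* In a left move the top digit of the left stack is pushed onto the right one. *)
    rewrite pop // modnMDl (modn_small gl1); split=> //.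
    + case=> [|u]; first by rewrite expn0 divn1 modnMDl modn_small // addn0 t1.
      by rewrite dS pop // r0d addnS.
    + have -> : B.+1 - j1 = (B.+1 - j1.+1).+1 by lia.
      by rewrite expnSr push_lt.
  - by [].
  - rewrite lE tj; split=> //.
      move=> u; rewrite -dS hd addSnnS tne //; lia.
have [pl' pr'] := pow_nR hB.
exists r'; split=> //; last first.
  exact: geq_minr.
(* The space bound on the new configuration keeps both stacks below [nR], so the reduction modulo
   [nS] disappears. *)
rewrite El modn_small //; apply: code_lt; rewrite ?qnum_lt ?geq_minr //.
  by apply: leq_trans pl'; apply: lrep_lt.
by apply: leq_trans pr'.
Qed.

Lemma delta_lt b a : delta b a < nS.
Proof. by rewrite /delta ev_mod ev_S ?nS_gt0 // ltn_pmod ?nS_gt0. Qed.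

(** Code 0 has state number 0, which counts as halted, so the transition keeps it. *)
Lemma delta0 b : delta b 0 = 0.
Proof.
have he : eval x (envx x 0) (EVar true) = code 0 0 0 0 by rewrite /code !muln0.
by rewrite /delta (ev_delta_halted b he) ?nR_gt0 // /code !muln0.
Qed.

Definition acode (a : nat) : bool := accepting (a %% nq).

(** The empty left stack is 1 and the all-blank right stack is 0. *)
Definition icode : nat := code (qnum (ptm_start M)) 0 1 0.

Lemma nR_gt1 : 1 < nR.
Proof.
apply: leq_trans nR_ge; apply: leq_trans (_ : ng ^ 1 <= _); first by rewrite expn1 ng_gt1.
by rewrite leq_exp2l ?ng_gt1.
Qed.

Lemma icode_lt : icode < nS.
Proof. by apply: code_lt; rewrite ?qnum_lt ?nR_gt1 ?nR_gt0. Qed.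

Lemma repc_init : repc (pinit M) icode.
Proof.
exists 0; split=> // [u|]; last by rewrite expn_gt0.
by rewrite div0n mod0n /gnum eqxx.
Qed.

Lemma acode_repc cf a : repc cf a -> acode a = ptm_acc M cf.1.1.1.
Proof.
case: cf => [[[q i] tp] j] [r [-> _ _ _ _]].
by rewrite /acode /code addnC mulnC modnMDl modn_small ?qnum_lt // /accepting qnumK.
Qed.

(** * Counting accepting coin sequences *)

Fixpoint pacc (t : nat) (cf : pcfg M) : nat :=
  if t is t'.+1 then pacc t' (pstep M x cf false) + pacc t' (pstep M x cf true)
  else ptm_acc M cf.1.1.1.

Lemma card_tupleS t (P : pred (seq bool)) :
  #|[set cs : t.+1.-tuple bool | P cs]| =
  #|[set cs : t.-tuple bool | P (false :: cs)]| + #|[set cs : t.-tuple bool | P (true :: cs)]|.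
Proof.
rewrite -!sum1dep_card.
rewrite (reindex (fun p : bool * t.-tuple bool => cons_tuple p.1 p.2)) /=; last first.
  exists (fun cs => (thead cs, behead_tuple cs)) => [[b cs]|cs] _ /=.
    by congr (_, _); apply/val_inj.
  by rewrite [RHS]tuple_eta; apply/val_inj.
rewrite -(pair_big_dep xpredT (fun b (cs : t.-tuple bool) => P (b :: cs)) (fun _ _ => 1)) /=.
by rewrite big_bool /= addnC.
Qed.

Lemma card_pacc t cf :
  #|[set cs : t.-tuple bool | ptm_acc M (foldl (pstep M x) cf cs).1.1.1]| = pacc t cf.
Proof.
elim: t cf => [|t IH] cf.
  rewrite -sum1dep_card (eq_bigl (fun cs => (ptm_acc M cf.1.1.1) && (cs == [tuple]))) /=.
    by case: (ptm_acc M _); rewrite ?big_pred1_eq ?big_pred0.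
  by move=> cs; have -> : cs == [tuple] by [apply/eqP; exact: tuple0]; rewrite andbT (tuple0 cs).
by rewrite (card_tupleS _ (fun cs => ptm_acc M (foldl (pstep M x) cf cs).1.1.1)) /= !IH.
Qed.

(** The induction follows only configurations reached by at most T coins. The space bound holds
    there, so each code met represents a true configuration. *)
Lemma cnt_pacc T : (forall cs : seq bool, size cs <= T -> (prun M x cs).2 <= B) ->
  cnt (delta false) (delta true) acode T icode = pacc T (pinit M).
Proof.
move=> hT; suff H t cs a : size cs + t = T -> repc (prun M x cs) a ->
    cnt (delta false) (delta true) acode t a = pacc t (prun M x cs).
  by apply: (H T [::]) => //; exact: repc_init.
elim: t cs a => [|t IH] cs a /= e ra; first by rewrite (acode_repc ra).
have st b : prun M x (rcons cs b) = pstep M x (prun M x cs) b by rewrite /prun foldl_rcons.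
have rb b : repc (prun M x (rcons cs b)) (delta b a).
  by rewrite st; apply: repc_step => //; rewrite -st; apply: hT; rewrite size_rcons; lia.
by rewrite -!st; congr (_ + _); apply: IH; rewrite ?size_rcons //; lia.
Qed.

(** * The gate family of the reduction *)

Definition eT : expr := ePow (EAdd (EVar false) (EConst 2)) k.
Definition eTop : expr := EMul (EAdd eT (EConst 1)) eS.
Definition eInit : expr :=
  EAdd (EMul eT eS) (eCode (EConst (qnum (ptm_start M))) (EConst 0) (EConst 1) (EConst 0)).
Definition eTime : expr := eDivp (EVar true) eS.
Definition eCfg : expr := eMod (EVar true) eS.
Definition eBody : expr := eLt (EVar true) eTop.
Definition eOff (u : nat) : expr := eEq (ESub (EVar true) eTop) (EConst u).
Definition ePrev (b : bool) : expr :=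
  EAdd (EMul (ESub eTime (EConst 1)) eS) (esubst eCfg (e_delta b (EVar true))).

(** Mirrors [cgate]: offsets 0 to 4 above [eTop] are the five final gates, the last one as the
    default branch. *)
Definition pl_family : gate_family := {|
  fam_out := EAdd eTop (EConst 4);
  fam_size := EAdd eTop (EConst 5);
  fam_kind := eIf eBody (eIf (eEq eTime (EConst 0)) (EConst 0) (EConst 1))
    (eIf (eOff 2) (EConst 2) (eIf (eOff 3) (EConst 0) (EConst 1)));
  fam_val := eIf eBody (EAdd (EConst 1) (e_acc eCfg)) (EConst 0);
  fam_p1 := eIf eBody (ePrev false)
    (eIf (eOff 0) eInit (eIf (eOff 1) (EMul eT eS)
    (eIf (eOff 2) eTop (EAdd eTop (EConst 2)))));
  fam_p2 := eIf eBody (ePrev true)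
    (eIf (eOff 0) eInit (eIf (eOff 1) (EConst 0)
    (eIf (eOff 2) (EAdd eTop (EConst 1)) (EAdd eTop (EConst 3))))) |}.

Notation T := ((size x).+2 ^ k).

Section Family.
Variable N : nat.
Notation ev := (eval x (envx x N)).

Lemma ev_T : ev eT = T.
Proof. by rewrite /eT ev_pow ev_add ev_const ev_var /envx addn2. Qed.
Lemma ev_Top : ev eTop = top nS T.
Proof. by rewrite /eTop ev_mul ev_add ev_T ev_S addn1. Qed.
Lemma ev_Init : ev eInit = T * nS + icode.
Proof. by rewrite /eInit ev_add ev_mul ev_T ev_S ev_code. Qed.
Lemma ev_Time : ev eTime = N %/ nS.
Proof. by rewrite /eTime ev_div ev_S ?nS_gt0. Qed.
Lemma ev_Cfg : ev eCfg = N %% nS.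
Proof. by rewrite /eCfg ev_mod ev_S ?nS_gt0. Qed.
Lemma ev_Body : ev eBody = (N < top nS T).
Proof. by rewrite /eBody ev_lt ev_Top. Qed.
Lemma ev_Off u : ev (eOff u) = (N - top nS T == u).
Proof. by rewrite /eOff ev_eq ev_sub ev_Top. Qed.

Lemma ev_Prev b : ev (ePrev b) = (N %/ nS).-1 * nS + delta b (N %% nS).
Proof. by rewrite /ePrev ev_add ev_mul ev_sub ev_Time ev_S ev_const subn1 eval_esubst ev_Cfg. Qed.

Lemma ev_acc : ev (e_acc eCfg) = acode (N %% nS).
Proof. by rewrite /e_acc ev_tab /e_q ev_mod ev_const // ev_Cfg ltn_pmod. Qed.

Lemma pl_gate :
  fam_gate pl_family x N = cgate nS T icode (delta false) (delta true) acode N.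
Proof.
rewrite /fam_gate /cgate.
have -> : ev (fam_kind pl_family) = if N < top nS T then nat_of_bool (N %/ nS != 0)
    else if N - top nS T == 2 then 2 else (N - top nS T != 3).
  rewrite /fam_kind /pl_family (ev_if _ _ ev_Body).
  rewrite (@ev_if _ _ _ _ _ (N %/ nS == 0)); last by rewrite ev_eq ev_Time.
  rewrite (ev_if _ _ (ev_Off 2)) (ev_if _ _ (ev_Off 3)) !ev_const.
  by case: ifP => _; [case: eqP|case: eqP => // _; case: eqP].
have -> : ev (fam_val pl_family) = if N < top nS T then 1 + acode (N %% nS) else 0.
  by rewrite /fam_val /pl_family (ev_if _ _ ev_Body) ev_add ev_acc.
have -> : ev (fam_p1 pl_family) = if N < top nS T then (N %/ nS).-1 * nS + delta false (N %% nS)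
    else match N - top nS T with 0 => T * nS + icode | 1 => T * nS | 2 => top nS T | _ => top nS T + 2 end.
  rewrite /fam_p1 /pl_family (ev_if _ _ ev_Body) ev_Prev (ev_if _ _ (ev_Off 0)) ev_Init.
  rewrite (ev_if _ _ (ev_Off 1)) ev_mul ev_T ev_S (ev_if _ _ (ev_Off 2)) ev_add ev_Top.
  by case: (N - _) => [|[|[|?]]].
have -> : ev (fam_p2 pl_family) = if N < top nS T then (N %/ nS).-1 * nS + delta true (N %% nS)
    else match N - top nS T with 0 => T * nS + icode | 1 => 0 | 2 => top nS T + 1 | _ => top nS T + 3 end.
  rewrite /fam_p2 /pl_family (ev_if _ _ ev_Body) ev_Prev (ev_if _ _ (ev_Off 0)) ev_Init.
  rewrite (ev_if _ _ (ev_Off 1)) (ev_if _ _ (ev_Off 2)) !ev_add ev_Top.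
  by case: (N - _) => [|[|[|?]]].
by case: ltnP => _; [case: eqP|case: (N - _) => [|[|[|[|?]]]]].
Qed.
End Family.

Lemma pl_circuit : fam_circuit pl_family x =
  (top nS T + 4, gates (cgate nS T icode (delta false) (delta true) acode) (top nS T + 5)).
Proof.
rewrite /fam_circuit /fam_width /fam_out /fam_size /pl_family !ev_add !ev_Top.
by congr (_, gates _ _); apply: functional_extensionality => N; exact: pl_gate.
Qed.

Lemma pl_circuit_correct : (forall cs : seq bool, size cs <= T -> (prun M x cs).2 <= B) ->
  MC O_times_div (enc_instance (fam_circuit pl_family x) 0) <->
  2 ^ T < 2 * #|[set cs : T.-tuple bool | ptm_acc M (prun M x cs).1.1.1]|.
Proof.
move=> hT; have S0 := nS_gt0.
have ac0 : acode 0 by rewrite /acode mod0n.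
have [d0 d1] := (delta_lt false, delta_lt true).
have ok := cgate_ok T acode S0 d0 d1 icode_lt.
rewrite pl_circuit (MC_enc 0 ok).
rewrite (circ_val_cgate T S0 d0 d1 icode_lt (delta0 false) (delta0 true) ac0).
by rewrite card_pacc cnt_pacc.
Qed.

End Simulation.

Theorem theorem9 : PL_hard (MC O_times_div).
Proof.
move=> L [M [k [c hL]]].
exists (fun x => enc_instance (fam_circuit (pl_family M k c) x) 0).
split; first exact: fam_logspace.
move=> x; have [_ [hB ->]] := hL x.
by rewrite (pl_circuit_correct hB).
Qed.
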